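(* Let $(f_0,g_0)\in L^\infty(\Omega)\times L^\infty(\Omega')$, let $\eta>0$ and define the gradient ascent iterates $$(f_{n+1},g_{n+1})=(f_n,g_n)+\eta\,\mathrm{D}\Gamma(f_n,g_n),\qquad n\ge0.$$ For every $\eta\in(0,\varepsilon)$ and $n\ge1$, $$\|f_{n}\oplus g_{n} - f_*\oplus g_*\|_\infty \leq 2 \|f_{0}\oplus g_{0} - f_*\oplus g_*\|_\infty$$ and the suboptimality gap $\Delta_n:=\mathrm{QOT}_\varepsilon(P,Q)-\Gamma(f_n,g_n)$ satisfies $$\Delta_n \leq (1-q)^n \Delta_0\qquad\text{for}\qquad q:=\frac{\eta \left(1-\frac{\eta }{\varepsilon} \right)} {\gamma_{\varepsilon}\max(2\|f_{0}\oplus g_{0} - f_*\oplus g_*\|_\infty, \varepsilon)}.$$ Moreover, $$\|f_n\oplus g_n - f_*\oplus g_*\|_{L^2(P\otimes Q)}^2\leq \frac{\gamma_\varepsilon^2\max(2\|f_{0}\oplus g_{0} - f_*\oplus g_*\|_\infty, \varepsilon)^2}{\eta \left(1-\frac{\eta }{\varepsilon} \right)}\,\Delta_0\,(1-q)^n.$$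
   Context: Fix $d\ge 1$ and $\varepsilon>0$. $B_r(x)\subset\mathbb{R}^d$ is the open ball of center $x$ and radius $r>0$. $P$ and $Q$ are probability measures on $\mathbb{R}^d$ such that: $P$ has convex, compact support $\Omega$ and a density $\rho=dP/d\mathcal{L}_d$ with respect to Lebesgue measure $\mathcal{L}_d$ with $\lambda_P\le\rho(x)\le\Lambda_P$ for all $x\in\Omega$, for constants $0<\lambda_P<\Lambda_P<\infty$; $Q$ has compact support $\Omega'$. The cost $c:\mathbb{R}^d\times\mathbb{R}^d\to\mathbb{R}$ is Lipschitz with constant $L>0$. $\delta_P\in(0,1]$ is a constant (it exists and depends only on $\Omega$ and $\lambda_P$) such that $P(B_r(x))\ge\delta_P\min(r^d,1)$ for all $r>0$, $x\in\Omega$. Set $$\gamma_\varepsilon= 16 \left(\delta_P^{-1}\max\left( \frac{8L}{\varepsilon},1\right)^d\right) \frac{\Lambda_P^2}{\lambda_P^2}\,\frac{\bigl(\lceil 8L\,\mathrm{diam}(\Omega)/\varepsilon \rceil\bigr)^{d+2}}{\inf_{y\in\Omega'} Q\bigl(B_{\frac{\varepsilon}{8L}}(y)\bigr)}.$$ With $\Pi(P,Q)$ the set of couplings of $(P,Q)$, $$\mathrm{QOT}_\varepsilon(P,Q):=\inf_{\pi\in\Pi(P,Q)}\int c\,d\pi+\frac{\varepsilon}{2}\left\|\frac{d\pi}{d(P\otimes Q)}\right\|^2_{L^2(P\otimes Q)},$$ the last term being $+\infty$ if $\pi\not\ll P\otimes Q$. The dual objective $\Gamma:L^2(P)\times L^2(Q)\to\mathbb{R}$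 is $$\Gamma(f,g):=\int\Big(f(x)+g(y)-\frac{1}{2\varepsilon}\big(f(x)+g(y)-c(x,y)\big)_+^2\Big)\,d(P\otimes Q)(x,y),$$ where $(t)_+=\max(t,0)$. Its gradient is $\mathrm{D}\Gamma(f,g)=(\mathrm{D}_1\Gamma(f,g),\mathrm{D}_2\Gamma(f,g))$ with $$\mathrm{D}_1\Gamma(f,g)(x)=1-\frac1\varepsilon\int (f(x)+g(y)-c(x,y))_+\,dQ(y),\qquad \mathrm{D}_2\Gamma(f,g)(y)=1-\frac1\varepsilon\int (f(x)+g(y)-c(x,y))_+\,dP(x),$$ evaluated for $x\in\Omega$, $y\in\Omega'$. Write $(f\oplus g)(x,y):=f(x)+g(y)$. Known facts: strong duality $\mathrm{QOT}_\varepsilon(P,Q)=\sup_{L^2(P)\times L^2(Q)}\Gamma$ holds; maximizers of $\Gamma$ exist and are unique up to $(f_*+a,g_*-a)$, $a\in\mathbb{R}$. The potentials $(f_*,g_* )$ are a fixed (arbitrary) maximizer, with versions $f_*:\Omega\to\mathbb{R}$, $g_*:\Omega'\to\mathbb{R}$ that are $L$-Lipschitz; they satisfy $\int (f_*(x)+g_*(y)-c(x,y))_+dQ(y)=\varepsilon$ for all $x\in\Omega$ and $\int (f_*(x)+g_*(y)-c(x,y))_+dP(x)=\varepsilon$ for all $y\in\Omega'$. $L^\infty(\Omega)$, $L^\infty(\Omega')$ are the spaces of bounded measurable functions, and $\|\cdot\|_\infty$ is the sup norm (on $\Omega$, $\Omega'$ or $\Omega\times\Omega'$). *)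

(* Defs.v *)
From HB Require Import structures.
From mathcomp Require Import all_boot all_order all_algebra.
From mathcomp Require Import all_classical all_reals all_analysis.
From mathcomp Require Import measurable_realfun.
Set Implicit Arguments.
Unset Strict Implicit.
Unset Printing Implicit Defensive.
Import Order.TTheory GRing.Theory Num.Theory.
Import numFieldNormedType.Exports.
Local Open Scope classical_set_scope.
Local Open Scope ring_scope.
Local Open Scope charge_scope.

(* The Borel sigma-algebra, generated by the open sets. *)
HB.instance Definition _ (R : realType) (m n : nat) :=
  Measurable.copy 'M[R]_(m, n) (g_sigma_algebraType (@open 'M[R]_(m, n))).

Section rV_measurability.
Context {R : realType}.

Lemma rV_open_measurable n (U : set 'rV[R]_n) : open U -> measurable U.
Proof. exact: sub_gen_smallest. Qed.

Lemma measurable_fun_coord n (i : 'I_n) :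
  measurable_fun [set: 'rV[R]_n] (fun x : 'rV[R]_n => x ord0 i).
Proof.
apply: (measurability _ (RGenOpens.measurableE R)).
move=> _ [_ [a [b ->]] <-].
have oU : open `]a, b[%classic by exact: (@interval_open R (BRight a) (BLeft b)).
apply: rV_open_measurable; rewrite setTI.
by move/continuousP: (@coord_continuous R 1 n ord0 i); exact.
Qed.

Lemma measurable_fun_rV d (T : measurableType d) n (f : T -> 'rV[R]_n) :
  (forall i, measurable_fun setT (fun t => f t ord0 i)) ->
  measurable_fun setT f.
Proof.
move=> mf.
apply: (@measurability _ _ _ _ _ _ (@open 'rV[R]_n)) => // _ [U oU <-].
rewrite setTI.
pose q (a : {ffun 'I_n -> rat}) : 'rV[R]_n := \row_i ratr (a i).
pose B (p : {ffun 'I_n -> rat} * nat) := ball (q p.1) (p.2.+1%:R^-1 : R).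
pose I := [set p | B p `<=` U].
have -> : U = \bigcup_(p in I) B p.
  apply/seteqP; split => [x Ux|x [p]]; last exact.
  have /nbhs_ballP[e /= e0 eU] : nbhs x U by exact: open_nbhs_nbhs.
  have [k ke] : exists k : nat, k.+1%:R^-1 < e / 2.
    exists (Num.truncn (e / 2)^-1).
    rewrite invf_plt ?posrE ?divr_gt0//; exact: truncnS_gt.
  have k0 : 0 < k.+1%:R^-1 :> R by rewrite invr_gt0.
  have /choice[a ax] : forall i : 'I_n, exists r : rat,
      `|x ord0 i - ratr r| < k.+1%:R^-1.
    move=> i.
    have /rat_in_itvoo[r] : x ord0 i - k.+1%:R^-1 < x ord0 i + k.+1%:R^-1.
      by rewrite ltrBlDr -addrA ltrDl addr_gt0.
    by rewrite in_itv/= => /andP[r1 r2]; exists r; rewrite ltr_distlC r1.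
  have Bx : ball (q [ffun i => a i]) (k.+1%:R^-1 : R) x.
    split => // i j; rewrite ord1 mxE ffunE -ball_normE /=.
    by rewrite distrC; exact: ax.
  exists ([ffun i => a i], k) => // y By; apply: eU.
  apply: (@le_ball _ _ _ (k.+1%:R^-1 + k.+1%:R^-1)).
    by rewrite (splitr e) ltW// ltrD.
  by apply: (ball_triangle _ By); exact: ball_sym.
rewrite preimage_bigcup bigcup_mkcond; apply: countable_bigcupT_measurable => //.
move=> p; case: ifP => // _.
have -> : f @^-1` B p = \bigcap_(i in [set: 'I_n])
    (fun t => f t ord0 i) @^-1` ball (ratr (p.1 i) : R) p.2.+1%:R^-1.
  apply/seteqP; split=> [t [_ Bt] i _|t Bt].
    by have := Bt ord0 i; rewrite mxE.
  split=> [|i j]; first by rewrite invr_gt0.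
  by rewrite ord1 mxE; exact: (Bt j Logic.I).
apply: fin_bigcap_measurable => // i _.
rewrite -[X in measurable X]setTI; apply: mf => //.
exact: measurable_ball.
Qed.

Definition cons_rV n (p : R * 'rV[R]_n) : 'rV[R]_n.+1 :=
  row_mx (const_mx p.1 : 'rV_1) p.2.

Lemma cons_rV0 n p : @cons_rV n p ord0 ord0 = p.1.
Proof.
have := row_mxEl (const_mx p.1 : 'rV_1) p.2 ord0 ord0.
by rewrite lshift0 [RHS]mxE.
Qed.

Lemma cons_rVS n p i : @cons_rV n p ord0 (lift ord0 i) = p.2 ord0 i.
Proof. by have := row_mxEr (const_mx p.1 : 'rV_1) p.2 ord0 i; rewrite rshift1. Qed.

Lemma measurable_cons_rV n :
  measurable_fun [set: measurableTypeR R * 'rV[R]_n] (@cons_rV n).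
Proof.
apply: measurable_fun_rV => i; case: (unliftP ord0 i) => [j ->|->].
  under eq_fun do rewrite cons_rVS.
  apply: (@measurableT_comp _ _ _ _ _ _ (fun x : 'rV[R]_n => x ord0 j) _ snd) => //.
  exact: measurable_fun_coord.
under eq_fun do rewrite cons_rV0; exact: measurable_fst.
Qed.

End rV_measurability.

Section lebesgue_rV.
Context {R : realType}.

(* d-dimensional Lebesgue measure as an iterated product measure; see
   lebesgue_rV_box for its value on boxes. *)
Fixpoint lebesgue_rV (n : nat) : set 'rV[R]_n -> \bar R :=
  if n is m.+1 then
    pushforward (lebesgue_measure \x @lebesgue_rV m)%E (@cons_rV R m)
  else dirac (0 : 'rV[R]_0).
Arguments lebesgue_rV : clear implicits.

Let lebesgue_rV_measure n :
  exists mu : {sigma_finite_measure set 'rV[R]_n -> \bar R},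
    (mu : set 'rV[R]_n -> \bar R) = lebesgue_rV n.
Proof.
elim: n => [|n [mu muE]] /=.
  by exists (dirac (0 : 'rV[R]_0)).
rewrite -muE.
pose cn : 'rV[R]_n.+1 -> 'rV[R]_n := fun x => \row_i x ord0 (lift ord0 i).
have mcn : measurable_fun setT cn.
  apply: measurable_fun_rV => i; under eq_fun do rewrite mxE.
  exact: measurable_fun_coord.
pose nu_ : {measure set 'rV[R]_n.+1 -> \bar R} :=
  pushforward (lebesgue_measure \x mu)%E (@cons_rV R n).
pose nu := nu_ (@measurable_cons_rV R n).
have snu : sigma_finite setT nu.
  have /sigma_finiteP[F [TF ndF Foo]] := sigma_finiteT (@lebesgue_measure R).
  have /sigma_finiteP[G [TG ndG Goo]] := sigma_finiteT mu.
  exists (fun k => (fun x : 'rV[R]_n.+1 => x ord0 ord0) @^-1` F k `&` cn @^-1` G k).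
    apply/seteqP; split => // x _.
    have [i _ Fi] : (\bigcup_i F i) (x ord0 ord0) by rewrite -TF.
    have [j _ Gj] : (\bigcup_j G j) (cn x) by rewrite -TG.
    exists (maxn i j) => //; split.
      by have /subsetPset := ndF _ _ (leq_maxl i j); apply.
    by have /subsetPset := ndG _ _ (leq_maxr i j); apply.
  move=> k; have [mF Fk] := Foo k; have [mG Gk] := Goo k; split.
    apply: measurableI; rewrite -[X in measurable X]setTI; last exact: mcn.
    exact: measurable_fun_coord.
  rewrite /nu /nu_ /= /pushforward [X in (_ \x _)%E X](_ : _ = F k `*` G k).
    by rewrite product_measure1E// lte_mul_pinfty// ge0_fin_numE.
  have cnK p : cn (cons_rV p) = p.2.
    by apply/rowP => i; rewrite mxE cons_rVS.
  by apply/seteqP; split => p /=; rewrite cons_rV0 cnK.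
pose sH := Measure_isSigmaFinite.Build _ _ _ nu snu.
pose nu' : {sigma_finite_measure set 'rV[R]_n.+1 -> \bar R} := HB.pack (Measure.sort nu) sH.
by exists nu'.
Qed.

Let lebesgue_rV0 n : lebesgue_rV n set0 = 0%E.
Proof. by have [mu <-] := lebesgue_rV_measure n; exact: measure0. Qed.

Let lebesgue_rV_ge0 n A : (0 <= lebesgue_rV n A)%E.
Proof. by have [mu <-] := lebesgue_rV_measure n; exact: measure_ge0. Qed.

Let lebesgue_rV_sigma_additive n : semi_sigma_additive (lebesgue_rV n).
Proof.
by have [mu <-] := lebesgue_rV_measure n; exact: measure_semi_sigma_additive.
Qed.

HB.instance Definition _ n := isMeasure.Build _ _ _ (lebesgue_rV n)
  (lebesgue_rV0 n) (@lebesgue_rV_ge0 n) (@lebesgue_rV_sigma_additive n).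

Let lebesgue_rV_sigma_finite n : sigma_finite setT (lebesgue_rV n).
Proof. by have [mu <-] := lebesgue_rV_measure n; exact: sigma_finiteT. Qed.

HB.instance Definition _ n := Measure_isSigmaFinite.Build _ _ _ (lebesgue_rV n)
  (lebesgue_rV_sigma_finite n).

Lemma lebesgue_rV_box n (a b : 'rV[R]_n) :
  (forall i, a ord0 i <= b ord0 i) ->
  lebesgue_rV n [set x | forall i, x ord0 i \in `[a ord0 i, b ord0 i]] =
  (\prod_(i < n) (b ord0 i - a ord0 i))%:E.
Proof.
elim: n a b => [|n IHn] a b ab.
  rewrite big_ord0 /= diracE mem_set// => i; by case: i.
rewrite /= /pushforward big_ord_recl EFinM.
pose a' : 'rV[R]_n := \row_i a ord0 (lift ord0 i).
pose b' : 'rV[R]_n := \row_i b ord0 (lift ord0 i).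
transitivity ((@lebesgue_measure R \x lebesgue_rV n)%E (`[a ord0 ord0, b ord0 ord0]%classic
    `*` [set x : 'rV[R]_n | forall i, x ord0 i \in `[a' ord0 i, b' ord0 i]])).
  congr (product_measure1 _ _ _); apply/seteqP.
  split => [p /= pab|p /= [p1 p2] i].
    split; first by have := pab ord0; rewrite cons_rV0.
    by move=> i; have := pab (lift ord0 i); rewrite cons_rVS !mxE.
  case: (unliftP ord0 i) => [j ->|->]; last by rewrite cons_rV0.
  by rewrite cons_rVS; have := p2 j; rewrite !mxE.
rewrite product_measure1E//; last first.
  rewrite (_ : [set _ | _] = \bigcap_(i in [set: 'I_n])
      (fun x : 'rV[R]_n => x ord0 i) @^-1` `[a' ord0 i, b' ord0 i]%classic).
    apply: fin_bigcap_measurable => // i _.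
    by rewrite -[X in measurable X]setTI; exact: measurable_fun_coord.
  by apply/seteqP; split => x /= xab i; [move=> _|]; exact: xab.
congr (_ * _)%E; last first.
  apply: (etrans (IHn a' b' _)) => [i|]; first by rewrite !mxE.
  by under eq_bigr do rewrite !mxE.
have := ab ord0; rewrite le_eqVlt => /predU1P[->|abl].
  by rewrite set_itv1 subrr; exact: lebesgue_measure_set1.
by apply: (etrans (lebesgue_measure_itv _)); rewrite /= lte_fin abl EFinB.
Qed.

End lebesgue_rV.

Arguments lebesgue_rV {R} n.

(* The norm that the library puts on 'rV[R]_d is the sup norm; it has the same
   topology as the Euclidean norm below, but neither the same balls nor the same
   Lipschitz constants. *)
Section euclidean.
Context {R : realType} {d : nat}.
Implicit Types (x y : 'rV[R]_d) (A : set 'rV[R]_d).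

Definition enorm x : R := Num.sqrt (\sum_(i < d) x ord0 i ^+ 2).

Definition eball x (r : R) : set 'rV[R]_d := [set y | enorm (y - x) < r].

Definition ediam A : R := sup [set enorm (z.1 - z.2) | z in A `*` A].

Definition elipschitz (L : R) A (f : 'rV[R]_d -> R) : Prop :=
  forall x y, A x -> A y -> `|f x - f y| <= L * enorm (x - y).

(* R^d x R^d carries the Euclidean norm of R^(d + d). *)
Definition elipschitz2 (L : R) (c : 'rV[R]_d -> 'rV[R]_d -> R) : Prop :=
  forall x y x' y',
    `|c x y - c x' y'| <=
    L * Num.sqrt (enorm (x - x') ^+ 2 + enorm (y - y') ^+ 2).

End euclidean.

Section measures_on_Rd.
Context {R : realType} {d : nat}.
Local Notation V := 'rV[R]_d.

Definition msupport (mu : {measure set V -> \bar R}) : set V :=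
  [set x | forall U : set V, open U -> U x -> (0 < mu U)%E].

Definition has_density (mu : {measure set V -> \bar R}) (rho : V -> R) : Prop :=
  [/\ measurable_fun setT rho, forall x, 0 <= rho x &
    forall A, measurable A -> mu A = (\int[lebesgue_rV d]_(x in A) (rho x)%:E)%E].

End measures_on_Rd.

Definition osum {R : realType} {T1 T2 : Type} (f : T1 -> R) (g : T2 -> R) :
  T1 * T2 -> R := fun z => f z.1 + g z.2.

(* Valued in \bar R, so that it is +oo on unbounded functions. *)
Definition supnorm {R : realType} {T : Type} (A : set T) (h : T -> R) : \bar R :=
  ereal_sup [set `|h z|%:E | z in A].

(* Elements of L^oo(A) are represented by Borel functions on the whole space,
   of which only the values on A matter. *)
Definition Linfty {R : realType} {d : nat} (A : set 'rV[R]_d)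
    (f : 'rV[R]_d -> R) : Prop :=
  measurable_fun setT f /\ exists M : R, forall x, A x -> `|f x| <= M.

Section qot.
Context {R : realType} {d : nat}.
Local Notation V := 'rV[R]_d.
Variables (P Q : probability V R) (c : V -> V -> R) (eps : R).
Implicit Types (pi : probability (V * V)%type R) (f g : V -> R).

Definition prod_prob : probability (V * V)%type R := (P \x Q)%E.

Definition coupling pi : Prop :=
  forall A : set V, measurable A ->
    pi (A `*` setT) = P A /\ pi (setT `*` A) = Q A.

Definition chi2_penalty pi : \bar R :=
  if `[< pi `<< prod_prob >] then
    ('N[prod_prob]_2%:E['d (charge_of_finite_measure pi) '/d prod_prob] ^+ 2)%E
  else +oo%E.

Definition qot_cost pi : \bar R :=
  (\int[pi]_z (c z.1 z.2)%:E + (eps / 2)%:E * chi2_penalty pi)%E.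

Definition QOT : \bar R := ereal_inf [set qot_cost pi | pi in coupling].

Definition excess f g x y : R := Num.max (f x + g y - c x y) 0.

Definition Gam f g : R :=
  \int[prod_prob]_z
    (f z.1 + g z.2 - (2 * eps)^-1 * excess f g z.1 z.2 ^+ 2).

Definition D1Gam f g : V -> R :=
  fun x => 1 - eps^-1 * \int[Q]_y excess f g x y.

Definition D2Gam f g : V -> R :=
  fun y => 1 - eps^-1 * \int[P]_x excess f g x y.

Definition dual_maximizer f g : Prop :=
  [/\ f \in Lfun P 2%:E, g \in Lfun Q 2%:E &
    forall f' g', f' \in Lfun P 2%:E -> g' \in Lfun Q 2%:E ->
      Gam f' g' <= Gam f g].

Definition grad_step (eta : R) (fg : (V -> R) * (V -> R)) :
    (V -> R) * (V -> R) :=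
  (fun x => fg.1 x + eta * D1Gam fg.1 fg.2 x,
   fun y => fg.2 y + eta * D2Gam fg.1 fg.2 y).

Definition grad_iter (eta : R) f0 g0 (n : nat) : (V -> R) * (V -> R) :=
  iter n (grad_step eta) (f0, g0).

Definition gap f g : \bar R := (QOT - (Gam f g)%:E)%E.

End qot.

Definition gamma_const {R : realType} {d : nat} (eps L lam Lam delta : R)
    (Q : probability 'rV[R]_d R) (Omega Omega' : set 'rV[R]_d) : R :=
  16 * (delta^-1 * Num.max (8 * L / eps) 1 ^+ d) * (Lam ^+ 2 / lam ^+ 2) *
  ((Num.ceil (8 * L * ediam Omega / eps))%:~R ^+ (d + 2) /
   inf [set fine (Q (eball y (eps / (8 * L)))) | y in Omega']).

(* Main.v *)
Require Import Defs.
From HB Require Import structures.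
From mathcomp Require Import all_boot all_order all_algebra.
From mathcomp Require Import all_classical all_reals all_analysis.
From mathcomp Require Import measurable_realfun ring lra.
Import Order.TTheory GRing.Theory Num.Theory.
Import numFieldNormedType.Exports.
Local Open Scope classical_set_scope.
Local Open Scope ring_scope.

(** The iterates are compared with the maximizer [(fs, gs)] through the error
    [e = (f - fs) + (g - gs)], a sum of a function of [x] and a function of [y].

    Sup norm. The positive part being monotone and 1-Lipschitz, one step replaces
    the values of [f - fs] and of [gs - g] by averages of convex combinations of
    these values ([step_invariant]). They stay in the interval, of length at most
    twice the initial error, that contains them at the start
    ([common_interval]).

    Ascent. [Gam] is concave with second derivative of order [1 / eps]
    ([Gam_le_tangent], [Gam_ge_quadratic]), so that a step of length [eta] gains
    at least [eta (1 - eta / eps) |DGam|^2] ([step_ascent]).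

    Error bound. On the set [S] where [fs + gs - c >= eps / 2], the squared
    norm of [e] is at most [2 M] times the pairing [B] of the gradient with [- e],
    where [M >= eps] bounds [|e|] ([local_norm_le_pairing]). The first-order conditions
    and the Lipschitz bounds show that [S] contains, for every [x], a product of
    balls of radius [eps / (8 L)] around [x] and some [y], and likewise for every
    [y]. A Poincare inequality then recovers the full norm of [e] from its norm on
    [S] ([coupled_poincare]): the variance of [u = f - fs] is a double integral of
    squared differences; these are split into [N] steps along segments in the
    convex set [Omega], each step being short enough that both of its ends face a
    common ball inside [S] ([local_poincare], [near_diff_le]); [v = g - gs] is
    then read off from [u + v] on [S]. Together with Young's inequality this gives
    [|e|^2 <= (gamma M |DGam|)^2] ([error_bound]) and, by concavity, the
    Polyak-Lojasiewicz inequality [max Gam - Gam <= gamma M |DGam|^2]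
    ([polyak_lojasiewicz]). Both rates follow ([linear_rate]).

    Duality. The maximum of [Gam] equals [QOT] ([strong_duality]): weak duality is
    Young's inequality, and the first-order conditions say that
    [(fs + gs - c)_+ / eps] is the density of a coupling, which attains the dual
    value. These conditions hold almost surely because a step along the gradient
    cannot increase [Gam] ([maximizer_D1_ae]), and on the whole supports by
    Lipschitz continuity ([D1Gam_eq0]). *)

Set Implicit Arguments.
Unset Strict Implicit.
Unset Printing Implicit Defensive.

(** * Bounded measurable functions on a probability space *)

(** A measurable set carrying all the mass of [mu]. *)
Definition full {d} {T : measurableType d} {R : realType}
  (mu : probability T R) (A : set T) : Prop := measurable A /\ mu A = 1%E.

(** Measurable functions that are bounded on [A]; nothing is required of their
    size off [A]. For [T = R^d] this is [Linfty]. *)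
Definition bmfun {d} {T : measurableType d} {R : realType} (A : set T)
  (f : T -> R) : Prop :=
  measurable_fun setT f /\ exists M : R, forall x, A x -> `|f x| <= M.

Section bmfun_closure.
Context d (T : measurableType d) (R : realType) (A : set T).
Implicit Types f g : T -> R.

Lemma bm_cst (k : R) : bmfun A (fun=> k).
Proof. by split; [exact: measurable_cst | exists `|k|]. Qed.

Lemma bmD f g : bmfun A f -> bmfun A g -> bmfun A (fun x => f x + g x).
Proof.
move=> [mf [M fM]] [mg [N gN]]; split; first exact: measurable_funD.
exists (M + N) => x Ax; apply: le_trans (ler_normD _ _) _.
by rewrite lerD ?fM ?gN.
Qed.

Lemma bmN f : bmfun A f -> bmfun A (fun x => - f x).
Proof.
move=> [mf [M fM]]; split; first exact: measurable_funN.
by exists M => x Ax; rewrite normrN fM.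
Qed.

Lemma bmM f g : bmfun A f -> bmfun A g -> bmfun A (fun x => f x * g x).
Proof.
move=> [mf [M fM]] [mg [N gN]]; split; first exact: measurable_funM.
by exists (M * N) => x Ax; rewrite normrM ler_pM ?fM ?gN.
Qed.

Lemma bmX f n : bmfun A f -> bmfun A (fun x => f x ^+ n).
Proof.
move=> [mf [M fM]]; split; first exact: measurable_funX.
exists (M ^+ n) => x Ax; rewrite normrX lerXn2r ?nnegrE ?fM//.
by apply: le_trans (fM x Ax).
Qed.

Lemma bm_max0 f : bmfun A f -> bmfun A (fun x => Num.max (f x) 0).
Proof.
move=> [mf [M fM]]; split; first exact: measurable_maxr.
exists M => x Ax; apply: le_trans (fM x Ax).
by case: (leP (f x) 0) => h; rewrite ?normr0.
Qed.

Lemma bm_indic (S : set T) : measurable S -> bmfun A (\1_S : T -> R).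
Proof.
move=> mS; split; first exact: measurable_indic.
exists 1 => x _; rewrite indicE; case: (x \in S) => /=; by rewrite ?normr0 ?normr1.
Qed.

End bmfun_closure.

(** Reduces boundedness of an arithmetic expression to that of its leaves. *)
Ltac bm := repeat first [ assumption | apply: bm_cst | apply: bmD | apply: bmN
  | apply: bmM | apply: bmX | apply: bm_max0 ].

Section full_integral.
Context d (T : measurableType d) (R : realType) (mu : probability T R)
  (A : set T).
Hypothesis fA : full mu A.
Implicit Types f g : T -> R.

Lemma full_setC : mu (~` A) = 0%E.
Proof. by case: fA => mA A1; rewrite probability_setC// A1 subee. Qed.

Lemma full_nonempty : exists x, A x.
Proof.
apply/set0P/eqP => A0; case: fA => _; rewrite A0 measure0 => /esym/eqP.
by rewrite eqe oner_eq0.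
Qed.

Lemma integrable_bm f : bmfun A f -> mu.-integrable setT (EFin \o f).
Proof.
case: fA => mA A1 [mf [M fM]].
apply/(@negligible_integrable _ _ _ mu setT (~` A)) => //.
- exact: measurableC.
- exact/measurable_EFinP.
- exact: full_setC.
rewrite setTD setCK; apply: measurable_bounded_integrable => //.
- by rewrite (le_lt_trans (probability_le1 mu mA)) ?ltry.
- exact: measurable_funTS.
- exists M; split; first exact: num_real.
  by move=> x Mx y Ay /=; apply: le_trans (fM y Ay) (ltW Mx).
Qed.

Lemma integral_bmE f : bmfun A f ->
  (\int[mu]_x (f x)%:E)%E = (\int[mu]_x f x)%:E.
Proof.
move=> bf; rewrite /Rintegral fineK//; apply: integrable_fin_num => //.
exact: integrable_bm.
Qed.

Lemma Rint_full f : bmfun A f -> \int[mu]_x f x = \int[mu]_(x in A) f x.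
Proof.
move=> bf; case: (fA) => mA _; rewrite /Rintegral; congr fine.
rewrite (@negligible_integral _ _ _ mu setT (~` A)) ?setTD ?setCK//.
- exact: measurableC.
- exact: integrable_bm.
- exact: full_setC.
Qed.

Lemma Rint_le f g : bmfun A f -> bmfun A g -> (forall x, A x -> f x <= g x) ->
  \int[mu]_x f x <= \int[mu]_x g x.
Proof.
move=> bf bg fg; case: (fA) => mA _; rewrite !Rint_full//.
by apply: le_Rintegral => //; apply: (@integrableS _ _ _ _ setT) => //; exact: integrable_bm.
Qed.

Lemma Rint_eq f g : bmfun A f -> bmfun A g -> (forall x, A x -> f x = g x) ->
  \int[mu]_x f x = \int[mu]_x g x.
Proof.
by move=> bf bg fg; apply/eqP; rewrite eq_le !Rint_le// => x /fg->.
Qed.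

Lemma Rint_cst (k : R) : \int[mu]_x k = k.
Proof. by rewrite Rintegral_cst// [X in fine X](probability_setT mu) mulr1. Qed.

Lemma RintD f g : bmfun A f -> bmfun A g ->
  \int[mu]_x (f x + g x) = \int[mu]_x f x + \int[mu]_x g x.
Proof. by move=> bf bg; rewrite RintegralD//; exact: integrable_bm. Qed.

Lemma RintZ (k : R) f : bmfun A f ->
  \int[mu]_x (k * f x) = k * \int[mu]_x f x.
Proof. by move=> bf; rewrite RintegralZl//; exact: integrable_bm. Qed.

Lemma RintN f : bmfun A f -> \int[mu]_x (- f x) = - \int[mu]_x f x.
Proof.
by move=> bf; rewrite -mulN1r -RintZ//; apply: eq_Rintegral => x _; rewrite mulN1r.
Qed.

Lemma RintB f g : bmfun A f -> bmfun A g ->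
  \int[mu]_x (f x - g x) = \int[mu]_x f x - \int[mu]_x g x.
Proof. by move=> bf bg; rewrite RintD ?RintN//; bm. Qed.

Lemma Rint_ge f k : bmfun A f -> (forall x, A x -> k <= f x) ->
  k <= \int[mu]_x f x.
Proof. by move=> bf kf; rewrite -[leLHS]Rint_cst; apply: Rint_le => //; bm. Qed.

Lemma Rint_bound f k : bmfun A f -> (forall x, A x -> f x <= k) ->
  \int[mu]_x f x <= k.
Proof. by move=> bf kf; rewrite -[leRHS]Rint_cst; apply: Rint_le => //; bm. Qed.

Lemma Rint_abs_le f k : bmfun A f -> (forall x, A x -> `|f x| <= k) ->
  `|\int[mu]_x f x| <= k.
Proof.
move=> bf fk; rewrite ler_norml Rint_ge ?Rint_bound// => x Ax;
by have := fk x Ax; rewrite ler_norml => /andP[].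
Qed.

Lemma Rint_eq0 f : bmfun A f -> (forall x, A x -> 0 <= f x) ->
  \int[mu]_x f x = 0 -> mu (A `&` [set x | f x != 0]) = 0%E.
Proof.
move=> bf f0 If0; case: (fA) => mA _; case: (bf) => mf _.
have : (\int[mu]_(x in A) `|(EFin \o f) x|)%E = 0%E.
  have -> : (\int[mu]_(x in A) `|(EFin \o f) x|)%E = (\int[mu]_(x in A) (f x)%:E)%E.
    by apply: eq_integral => x /[!inE] Ax /=; rewrite ger0_norm ?f0.
  have := Rint_full bf; rewrite If0 /Rintegral => /esym.
  have fin : (\int[mu]_(x in A) (f x)%:E)%E \is a fin_num.
    apply: integrable_fin_num => //.
    by apply: (@integrableS _ _ _ _ setT) => //; exact: integrable_bm.
  by move=> h; rewrite -(fineK fin) h.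
have mEf : measurable_fun A (EFin \o f) by apply/measurable_EFinP; exact: measurable_funTS.
move/(ae_eq_integral_abs mu mA mEf) => [N [mN N0 AN]].
apply: (subset_measure0 _ _ _ N0) => //.
- apply: measurableI => //; rewrite -[X in measurable X]setTI.
  by apply: (mf measurableT [set t | t != 0]); rewrite -(setCK [set t | _]);
    apply: measurableC; rewrite (_ : ~` _ = [set 0]) //;
    apply/seteqP; split => t /=; [move/negP; rewrite negbK => /eqP|move->; apply/negP; rewrite negbK].
- move=> x [Ax /= /eqP fx]; apply: AN => /(_ Ax) /= [] h; exact: fx.
Qed.

Lemma Rint_attains f k : bmfun A f -> (forall x, A x -> f x <= k) ->
  \int[mu]_x f x = k -> exists2 x, A x & f x = k.
Proof.
move=> bf fk Ik; apply: contrapT => nex.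
have := @Rint_eq0 (fun x => k - f x).
rewrite RintB ?Rint_cst ?Ik ?subrr; try bm.
have -> : A `&` [set x | k - f x != 0] = A.
  apply/seteqP; split=> [x []//|x Ax]; split=> //=; apply/negP => /eqP h.
  by apply: nex; exists x => //; apply/eqP; rewrite eq_sym -subr_eq0 h.
case: fA => _ ->; move=> /(_ _ _ erefl) h.
have : (1 = 0 :> \bar R)%E; last by move/eqP; rewrite eqe oner_eq0.
by apply: h; [bm | move=> x Ax; rewrite subr_ge0 fk].
Qed.

End full_integral.

Section product_integral.
Context d1 d2 (T1 : measurableType d1) (T2 : measurableType d2) (R : realType)
  (P : probability T1 R) (Q : probability T2 R) (A : set T1) (B : set T2).
Hypotheses (fA : full P A) (fB : full Q B).
Let PQ : probability (T1 * T2)%type R := (P \x Q)%E.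

Lemma full_prod : full PQ (A `*` B).
Proof.
case: fA fB => mA A1 [mB B1]; split; first exact: measurableX.
by rewrite /PQ [LHS]product_measure1E// [X in (X * _)%E]A1 [X in (_ * X)%E]B1 mule1.
Qed.

Lemma bm_fst (f : T1 -> R) : bmfun A f -> bmfun (A `*` B) (fun z => f z.1).
Proof.
move=> [mf [M fM]]; split; last by exists M => z [/fM].
exact: measurableT_comp.
Qed.

Lemma bm_snd (f : T2 -> R) : bmfun B f -> bmfun (A `*` B) (fun z => f z.2).
Proof.
move=> [mf [M fM]]; split; last by exists M => z [_ /fM].
exact: measurableT_comp.
Qed.

Lemma bm_pair1 (F : T1 * T2 -> R) x : A x -> bmfun (A `*` B) F ->
  bmfun B (fun y => F (x, y)).
Proof.
move=> Ax [mF [M FM]]; split; last by exists M => y By; exact: FM.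
by apply: measurableT_comp => //; exact: pair1_measurable.
Qed.

Lemma bm_pair2 (F : T1 * T2 -> R) y : B y -> bmfun (A `*` B) F ->
  bmfun A (fun x => F (x, y)).
Proof.
move=> By [mF [M FM]]; split; last by exists M => x Ax; exact: FM.
by apply: measurableT_comp => //; exact: pair2_measurable.
Qed.

End product_integral.

(** No integrability is needed: [fine] and the difference of the integrals of
    the positive and negative parts are measurable operations. *)
Lemma measurable_Rint2 d1 d2 (T1 : measurableType d1) (T2 : measurableType d2)
  (R : realType) (Q : probability T2 R) (F : T1 * T2 -> R) :
  measurable_fun setT F -> measurable_fun setT (fun x => \int[Q]_y F (x, y)).
Proof.
move=> mF; rewrite /Rintegral.
apply: (@measurableT_comp _ _ _ _ _ _ fine) => //.
have mE : measurable_fun setT (EFin \o F) by exact/measurable_EFinP.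
rewrite (_ : (fun x => _) = (fubini_F Q (EFin \o F)^\+ \- fubini_F Q (EFin \o F)^\-)%E).
  by apply: emeasurable_funB; apply: measurable_fun_fubini_tonelli_F => //;
    [exact: measurable_funepos|exact: measurable_funeneg].
apply/funext => x; rewrite [LHS]integralE /fubini_F.
congr (_ - _)%E; apply: eq_integral => y _.
  by rewrite (@funepos_comp _ _ _ (EFin \o F) (pair x)).
by rewrite (@funeneg_comp _ _ _ (EFin \o F) (pair x)).
Qed.

Lemma measurable_Rint1 d1 d2 (T1 : measurableType d1) (T2 : measurableType d2)
  (R : realType) (P : probability T1 R) (F : T1 * T2 -> R) :
  measurable_fun setT F -> measurable_fun setT (fun y => \int[P]_x F (x, y)).
Proof.
move=> mF; apply: (@measurable_Rint2 _ _ T2 T1 R P (fun z => F (z.2, z.1))).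
by apply: measurableT_comp => //; exact: measurable_fun_pair.
Qed.

Section product_Fubini.
Context d1 d2 (T1 : measurableType d1) (T2 : measurableType d2) (R : realType)
  (P : probability T1 R) (Q : probability T2 R) (A : set T1) (B : set T2).
Hypotheses (fA : full P A) (fB : full Q B).
Let PQ : probability (T1 * T2)%type R := (P \x Q)%E.
Variable F : T1 * T2 -> R.
Hypothesis bF : bmfun (A `*` B) F.

Lemma bm_Rint2 : bmfun A (fun x => \int[Q]_y F (x, y)).
Proof.
split; first by apply: measurable_Rint2; case: bF.
case: (bF) => _ [M FM]; exists M => x Ax.
apply: (Rint_abs_le fB); first exact: bm_pair1 bF.
by move=> y By; exact: FM.
Qed.

Lemma bm_Rint1 : bmfun B (fun y => \int[P]_x F (x, y)).
Proof.
split; first by apply: measurable_Rint1; case: bF.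
case: (bF) => _ [M FM]; exists M => y By.
apply: (Rint_abs_le fA); first exact: bm_pair2 bF.
by move=> x Ax; exact: FM.
Qed.

Lemma Rint_prod12 : \int[PQ]_z F z = \int[P]_x \int[Q]_y F (x, y).
Proof.
have iF := integrable_bm (full_prod fA fB) bF.
rewrite {1}/Rintegral -(integral12_prod_meas1 iF) /Rintegral; congr fine.
rewrite [LHS](@negligible_integral _ _ _ P setT (~` A)) ?setTD ?setCK//; last 3 first.
- by case: fA => mA _; exact: measurableC.
- exact: (integrable_fubini_F iF).
- exact: full_setC.
rewrite [RHS](@negligible_integral _ _ _ P setT (~` A)) ?setTD ?setCK//; last 3 first.
- by case: fA => mA _; exact: measurableC.
- exact: (integrable_bm fA bm_Rint2).
- exact: full_setC.
apply: eq_integral => x /[!inE] Ax; rewrite /fubini_F.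
by apply: (integral_bmE fB); exact: bm_pair1 bF.
Qed.

Lemma Rint_prod21 : \int[PQ]_z F z = \int[Q]_y \int[P]_x F (x, y).
Proof.
have iF := integrable_bm (full_prod fA fB) bF.
rewrite {1}/Rintegral -(integral21_prod_meas1 iF) /Rintegral; congr fine.
rewrite [LHS](@negligible_integral _ _ _ Q setT (~` B)) ?setTD ?setCK//; last 3 first.
- by case: fB => mB _; exact: measurableC.
- pose F' z := F (z.2, z.1).
  have bF' : bmfun (B `*` A) F'.
    case: (bF) => mF [M FM]; split; last by exists M => z [Bz Az]; exact: FM.
    by apply: measurableT_comp => //; exact: measurable_fun_pair.
  exact: (integrable_fubini_F (integrable_bm (full_prod fB fA) bF')).
- exact: full_setC.
rewrite [RHS](@negligible_integral _ _ _ Q setT (~` B)) ?setTD ?setCK//; last 3 first.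
- by case: fB => mB _; exact: measurableC.
- exact: (integrable_bm fB bm_Rint1).
- exact: full_setC.
apply: eq_integral => y /[!inE] By; rewrite /fubini_G.
by apply: (integral_bmE fA); exact: bm_pair2 bF.
Qed.

End product_Fubini.

(** A centred function of the first variable is orthogonal to functions of the
    second. *)
Lemma Rint_sqr_sum d1 d2 (T1 : measurableType d1) (T2 : measurableType d2)
  (R : realType) (P : probability T1 R) (Q : probability T2 R) (A : set T1)
  (B : set T2) (u : T1 -> R) (v : T2 -> R) :
  full P A -> full Q B -> bmfun A u -> bmfun B v -> \int[P]_x u x = 0 ->
  \int[(P \x Q)%E]_z (u z.1 + v z.2) ^+ 2 =
    \int[P]_x u x ^+ 2 + \int[Q]_y v y ^+ 2.
Proof.
move=> fA fB bu bv u0.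
have bu1 := bm_fst B bu; have bv2 := bm_snd A bv.
have b1 : bmfun (A `*` B) (fun z => (u z.1 + v z.2) ^+ 2) by bm.
rewrite (Rint_prod12 fA fB b1) /=.
rewrite (_ : \int[P]_x _ = \int[P]_x (u x ^+ 2 + 2 * (\int[Q]_y v y) * u x +
    \int[Q]_y v y ^+ 2)).
  rewrite (RintD fA) ?(RintD fA) ?(RintZ fA) ?Rint_cst; try bm.
  by rewrite u0 mulr0 addr0.
apply: (Rint_eq fA); [exact: (bm_Rint2 fB b1)|bm|] => x Ox /=.
rewrite (_ : \int[Q]_y _ = \int[Q]_y (u x ^+ 2 + 2 * u x * v y + v y ^+ 2)); last first.
  by apply: eq_Rintegral => y _; ring.
rewrite (RintD fB) ?(RintD fB) ?(RintZ fB) ?Rint_cst; try bm.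
by ring.
Qed.

(** * The Euclidean norm, Borel sets and supports in R^d *)

Section euclidean_norm.
Context (R : realType) (d : nat).
Implicit Types v x y : 'rV[R]_d.

Lemma enorm_ge0 v : 0 <= enorm v.
Proof. exact: sqrtr_ge0. Qed.

Lemma enorm0 : enorm (0 : 'rV[R]_d) = 0.
Proof. by rewrite /enorm big1 ?sqrtr0// => i _; rewrite mxE expr0n. Qed.

Lemma enormN v : enorm (- v) = enorm v.
Proof. by congr Num.sqrt; apply: eq_bigr => i _; rewrite mxE sqrrN. Qed.

Lemma enormZ (k : R) v : 0 <= k -> enorm (k *: v) = k * enorm v.
Proof.
move=> k0; rewrite /enorm -[k in RHS]ger0_norm// -sqrtr_sqr -sqrtrM ?sqr_ge0//.
by congr Num.sqrt; rewrite mulr_sumr; apply: eq_bigr => i _; rewrite mxE exprMn.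
Qed.

Lemma enorm_coord v (e : R) : 0 <= e -> (forall i, `|v ord0 i| <= e) ->
  enorm v <= d%:R * e.
Proof.
move=> e0 ve; have -> : d%:R * e = Num.sqrt ((d%:R * e) ^+ 2).
  by rewrite sqrtr_sqr ger0_norm// mulr_ge0.
rewrite ler_wsqrtr//; apply: (@le_trans _ _ (\sum_(i < d) e ^+ 2)).
  by apply: ler_sum => i _; rewrite -real_normK ?num_real// lerXn2r ?nnegrE.
rewrite sumr_const card_ord -[leLHS]mulr_natl exprMn ler_wpM2r ?sqr_ge0//.
by rewrite -natrX ler_nat; case: (d) => // n; rewrite leq_pmulr.
Qed.

Lemma enorm_ball x y (e : R) : ball x e y -> enorm (x - y) <= d%:R * e.
Proof.
move=> [e0 xy]; apply: enorm_coord; first exact: ltW.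
by move=> i; rewrite !mxE; exact: ltW (xy ord0 i).
Qed.

Lemma sqrt_sum_sqr_le (a b : R) : 0 <= a -> 0 <= b ->
  Num.sqrt (a ^+ 2 + b ^+ 2) <= a + b.
Proof.
move=> a0 b0; rewrite -[leRHS]ger0_norm ?addr_ge0// -sqrtr_sqr.
by rewrite ler_wsqrtr// sqrrD lerD2r lerDl mulrn_wge0// mulr_ge0.
Qed.

Lemma measurable_enorm : measurable_fun setT (@enorm R d).
Proof.
apply: (@measurableT_comp _ _ _ _ _ _ (@Num.sqrt R)) => //.
  by apply: continuous_measurable_fun; exact: sqrt_continuous.
apply: measurable_sum => i; apply: measurable_funX.
exact: measurable_fun_coord.
Qed.

Lemma elipschitz2_sum (L : R) (c : 'rV[R]_d -> 'rV[R]_d -> R) :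
  0 <= L -> elipschitz2 L c -> forall x y x' y',
  `|c x y - c x' y'| <= L * (enorm (x - x') + enorm (y - y')).
Proof.
move=> L0 cL x y x' y'; apply: le_trans (cL x y x' y') _.
by rewrite ler_wpM2l// sqrt_sum_sqr_le// enorm_ge0.
Qed.

Lemma bounded_coord (A : set 'rV[R]_d) : compact A ->
  exists M : R, 0 <= M /\ forall x, A x -> forall i, `|x ord0 i| <= M.
Proof.
move=> cA; have [M [Mr AM]] := compact_bounded cA.
exists (`|M| + 1); split=> [|x Ax i]; first by rewrite addr_ge0.
have := AM (`|M| + 1); rewrite ltr_pwDr ?ler_norm// => /(_ isT x Ax) /=.
apply: le_trans; rewrite /Num.norm/= mx_normrE.
exact: (@le_bigmax _ _ _ 0 (fun ij : 'I_1 * 'I_d => `|x ij.1 ij.2|) (ord0, i)).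
Qed.

Lemma enorm_bounded (A : set 'rV[R]_d) : compact A ->
  exists2 M : R, 0 <= M & forall x y, A x -> A y -> enorm (x - y) <= M.
Proof.
move=> /bounded_coord[M [M0 AM]]; exists (d%:R * (M + M)).
  by rewrite mulr_ge0// addr_ge0.
move=> x y Ax Ay; apply: enorm_coord; first by rewrite addr_ge0.
move=> i; rewrite !mxE; apply: le_trans (ler_normB _ _) _.
by rewrite lerD// AM.
Qed.

Lemma enorm_le_ediam (A : set 'rV[R]_d) x y : compact A -> A x -> A y ->
  enorm (x - y) <= ediam A.
Proof.
move=> /enorm_bounded[M M0 AM] Ax Ay; apply: ub_le_sup.
  by exists M => _ [[z z'] /= [Az Az'] <-]; exact: AM.
by exists (x, y).
Qed.

Lemma elipschitz_bounded (L : R) (A : set 'rV[R]_d) f : 0 <= L -> compact A ->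
  elipschitz L A f -> exists M : R, forall x, A x -> `|f x| <= M.
Proof.
move=> L0 cA fL; have [[x0 Ax0]|A0] := pselect (exists x, A x); last first.
  by exists 0 => x Ax; case: A0; exists x.
have [M M0 AM] := enorm_bounded cA.
exists (`|f x0| + L * M) => x Ax.
rewrite -[f x](subrK (f x0)) addrC; apply: le_trans (ler_normD _ _) _.
by rewrite lerD2l (le_trans (fL _ _ Ax Ax0))// ler_wpM2l// AM.
Qed.

End euclidean_norm.

Section borel.
Context (R : realType).

Lemma closed_measurable_rV d (A : set 'rV[R]_d) : closed A -> measurable A.
Proof.
by move=> cA; rewrite -(setCK A); apply: measurableC;
  apply: rV_open_measurable; exact: closed_openC.
Qed.

Lemma compact_measurable_rV d (A : set 'rV[R]_d) : compact A -> measurable A.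
Proof.
move=> cA; apply: closed_measurable_rV; exact: compact_closed.
Qed.

Lemma continuous_measurable_rV d (f : 'rV[R]_d -> R) : continuous f ->
  measurable_fun setT f.
Proof.
move=> cf; apply: (measurability _ (RGenOpens.measurableE R)).
move=> _ [_ [a [b ->]] <-]; rewrite setTI.
apply: rV_open_measurable; move/continuousP: cf; apply.
exact: (@interval_open R (BRight a) (BLeft b)).
Qed.

(** The Borel sets of R^d x R^d lie in the product sigma-algebra: [c] is
    read as a continuous function on R^(d + d). *)
Lemma elipschitz2_measurable d (L : R) (c : 'rV[R]_d -> 'rV[R]_d -> R) :
  0 <= L -> elipschitz2 L c ->
  measurable_fun setT (fun z : 'rV[R]_d * 'rV[R]_d => c z.1 z.2).
Proof.
move=> L0 cL.
pose cc (w : 'rV[R]_(d + d)) := c (lsubmx w) (rsubmx w).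
pose j (z : 'rV[R]_d * 'rV[R]_d) : 'rV[R]_(d + d) := row_mx z.1 z.2.
have -> : (fun z => c z.1 z.2) = cc \o j.
  by apply/funext => z; rewrite /cc /j /= row_mxKl row_mxKr.
apply: measurableT_comp.
  apply: continuous_measurable_rV => w U /(nbhs_ballP (cc w)) [e /= e0 eU].
  pose k := L * (d%:R + d%:R) + 1.
  have k0 : 0 < k by rewrite ltr_wpDl// mulr_ge0// addr_ge0.
  apply/nbhs_ballP; exists (e / k) => /=; first by rewrite divr_gt0.
  move=> w' [ek0 ww']; apply: eU; rewrite /ball /=.
  apply: (le_lt_trans (elipschitz2_sum L0 cL _ _ _ _)).
  apply: (@le_lt_trans _ _ (L * (d%:R * (e / k) + d%:R * (e / k)))).
    rewrite ler_wpM2l// lerD// enorm_ball//; split=> // i i'; rewrite !mxE;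
    exact: ww'.
  have t0 : 0 < e / k by rewrite divr_gt0.
  have et : e / k * k = e by rewrite divfK// gt_eqF.
  apply: (@lt_le_trans _ _ (e / k * k)); last by rewrite et.
  by move: (e / k) t0 => t t0; rewrite /k; nra.
apply: measurable_fun_rV => i; rewrite /j.
rewrite -(splitK i); case: (fintype.split i) => i' /=.
  under eq_fun do rewrite row_mxEl.
  by apply: (@measurableT_comp _ _ _ _ _ _ (fun x : 'rV[R]_d => x ord0 i') _ fst) => //;
    exact: measurable_fun_coord.
under eq_fun do rewrite row_mxEr.
by apply: (@measurableT_comp _ _ _ _ _ _ (fun x : 'rV[R]_d => x ord0 i') _ snd) => //;
  exact: measurable_fun_coord.
Qed.

(** Balls with rational centre and radius [1 / (k + 1)]. *)
Definition ratball d (p : {ffun 'I_d -> rat} * nat) : set 'rV[R]_d :=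
  ball (\row_i ratr (p.1 i) : 'rV[R]_d) (p.2.+1%:R^-1 : R).

Lemma ratball_basis d (U : set 'rV[R]_d) x : open U -> U x ->
  exists p, ratball p x /\ ratball p `<=` U.
Proof.
move=> oU Ux; have /nbhs_ballP[e /= e0 eU] : nbhs x U by exact: open_nbhs_nbhs.
have [k ke] : exists k : nat, k.+1%:R^-1 < e / 2.
  exists (Num.truncn (e / 2)^-1).
  rewrite invf_plt ?posrE ?divr_gt0//; exact: truncnS_gt.
have k0 : 0 < k.+1%:R^-1 :> R by rewrite invr_gt0.
have /choice[a ax] i : exists r : rat, `|x ord0 i - ratr r| < k.+1%:R^-1.
  have /rat_in_itvoo[r] : x ord0 i - k.+1%:R^-1 < x ord0 i + k.+1%:R^-1.
    by rewrite ltrBlDr -addrA ltrDl addr_gt0.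
  by rewrite in_itv/= => /andP[r1 r2]; exists r; rewrite ltr_distlC r1.
have Bx : ratball ([ffun i => a i], k) x.
  split => // i j; rewrite ord1 mxE ffunE -ball_normE /= distrC; exact: ax.
exists ([ffun i => a i], k); split=> // y By; apply: eU.
apply: (@le_ball _ _ _ (k.+1%:R^-1 + k.+1%:R^-1)).
  by rewrite (splitr e) ltW// ltrD.
by apply: (ball_triangle _ By); exact: ball_sym.
Qed.

Lemma measurable_ratball d p : measurable (@ratball d p).
Proof. apply: rV_open_measurable; exact: ball_open. Qed.

(** The complement of the support is covered by the countably many null
    rational balls. *)
Lemma full_msupport d (mu : probability 'rV[R]_d R) :
  compact (msupport mu) -> full mu (msupport mu).
Proof.
move=> cS; have mS := compact_measurable_rV cS; split => //.
have : mu.-negligible (~` msupport mu).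
  pose F k := if @unpickle ({ffun 'I_d -> rat} * nat)%type k is Some p then
    if mu (ratball p) == 0%E then ratball p else set0 else set0.
  apply: (@negligibleS _ _ _ mu (\bigcup_k F k)); last first.
    apply: negligible_bigcup => k; rewrite /F; case: unpickle => [p|]; last first.
      exact: negligible_set0.
    case: eqP => [p0|_]; last exact: negligible_set0.
    by apply/negligibleP => //; exact: measurable_ratball.
  move=> x /= nx.
  have [U [oU Ux U0]] : exists U : set 'rV[R]_d, [/\ open U, U x & mu U = 0%E].
    apply: contrapT => nU; apply: nx => U oU Ux.
    rewrite lt0e measure_ge0 andbT; apply/eqP => U0.
    by apply: nU; exists U.
  have [p [px pU]] := ratball_basis oU Ux.
  exists (pickle p) => //; rewrite /F pickleK.
  suff -> : mu (ratball p) = 0%E by rewrite eqxx.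
  apply: (subset_measure0 _ _ pU) => //; first exact: measurable_ratball.
  exact: rV_open_measurable.
move/negligibleP => /(_ (measurableC mS)) h.
have := probability_setC mu mS; rewrite h => h'.
have f1 : mu (msupport mu) \is a fin_num by exact: fin_num_measure.
have := f1; case E : (mu (msupport mu)) => [r| |] // _.
by move: h'; rewrite E -EFinB => -[] /esym/eqP; rewrite subr_eq0 => /eqP <-.
Qed.

(** A property holding almost surely holds arbitrarily close to every point of
    the support. *)
Lemma msupport_dense d (mu : probability 'rV[R]_d R) (N : set 'rV[R]_d) x e :
  compact (msupport mu) -> msupport mu x -> 0 < e ->
  mu (msupport mu `&` N) = 0%E -> measurable N ->
  exists x', [/\ msupport mu x', ~ N x' & ball x e x'].
Proof.
move=> cS Sx e0 N0 mN; have [mS S1] := full_msupport cS.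
apply: contrapT => nex.
have obe : open (ball x e) by exact: ball_open.
move: (Sx _ obe (ballxx _ e0)); apply/negP; rewrite -leNgt le_eqVlt.
apply/orP; left; apply/eqP.
apply: (@subset_measure0 _ _ _ mu _ (~` msupport mu `|` (msupport mu `&` N))).
- exact: rV_open_measurable.
- by apply: measurableU; [exact: measurableC|exact: measurableI].
- move=> y xy; have [Sy|nSy] := pselect (msupport mu y); last by left.
  right; split => //; apply: contrapT => Ny; apply: nex; by exists y.
- rewrite [LHS](@measureU0 _ _ _ mu _ _ (measurableC mS) (measurableI _ _ mS mN) N0).
  exact: full_setC (full_msupport cS).
Qed.

End borel.

(** * Affine changes of variables for Lebesgue measure *)

Lemma ge0_integral_scaling d (T : measurableType d) (R : realType)
  (mu : {measure set T -> \bar R}) (phi : T -> T) (s : R) (F : T -> \bar R) :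
  0 <= s -> measurable_fun setT phi ->
  (forall A, measurable A -> mu (phi @^-1` A) = (s%:E * mu A)%E) ->
  measurable_fun setT F -> (forall x, 0 <= F x)%E ->
  (\int[mu]_x F (phi x) = s%:E * \int[mu]_x F x)%E.
Proof.
move=> s0 mphi scal mF F0.
have := @ge0_integral_pushforward _ _ T T R phi mphi mu setT F measurableT mF.
rewrite preimage_setT => <-; last by move=> x _; exact: F0.
rewrite -[s]/((NngNum s0)%:num) -ge0_integral_mscale//.
by apply: eq_measure_integral => A mA _; rewrite /= /pushforward /mscale scal.
Qed.

Section lebesgue_affine.
Context (R : realType).
Local Notation leb := (@lebesgue_measure R).

Lemma measurable_affine1 (k a : R) :
  measurable_fun [set: measurableTypeR R]
    (fun x : measurableTypeR R => k * x + a : measurableTypeR R).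
Proof. by apply: measurable_funD => //; apply: measurable_funM. Qed.

Lemma lebesgue_measure_affine (k a : R) (A : set (measurableTypeR R)) : 0 < k ->
  measurable A -> leb ((fun x => k * x + a) @^-1` A) = ((k^-1)%:E * leb A)%E.
Proof.
move=> k0 mA.
pose phi (x : measurableTypeR R) : measurableTypeR R := k * x + a.
have mphi : measurable_fun setT phi by exact: measurable_affine1.
pose m0 : {measure set (measurableTypeR R) -> \bar R} := pushforward leb phi.
pose m : {measure set (measurableTypeR R) -> \bar R} :=
  mscale (NngNum (ltW k0)) (m0 mphi).
have mE : leb A = m A.
  apply: lebesgue_measure_unique => // X /ocitvP[->|[[u v] /= uv ->]].
    by rewrite !measure0.
  rewrite /m /= /mscale /= /pushforward.
  have -> : phi @^-1` `]u, v]%classic = `](u - a) / k, (v - a) / k]%classic.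
    apply/seteqP; split => x; rewrite /= !in_itv/= /phi ltr_pdivrMr// ler_pdivlMr//;
    by rewrite ltrBlDr lerBrDr mulrC.
  rewrite !lebesgue_measure_itv/= !lte_fin uv ltr_pM2r ?invr_gt0// ltrD2r uv.
  rewrite -!EFinB -EFinM; congr EFin; rewrite -mulrBl mulrC divfK ?gt_eqF//.
  by rewrite opprB addrA subrK.
rewrite mE /m /= /mscale /= /pushforward muleA -EFinM mulVf ?gt_eqF//.
by rewrite mul1e.
Qed.

Lemma measurable_affine n (k : R) (a : 'rV[R]_n) :
  measurable_fun setT (fun x : 'rV[R]_n => k *: x + a).
Proof.
apply: measurable_fun_rV => i; under eq_fun do rewrite !mxE.
apply: measurable_funD => //; apply: measurable_funM => //.
exact: measurable_fun_coord.
Qed.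

Lemma measurable_lincomb n (a b : R) :
  measurable_fun setT (fun z : 'rV[R]_n * 'rV[R]_n => a *: z.1 + b *: z.2).
Proof.
apply: measurable_fun_rV => i; under eq_fun do rewrite !mxE.
apply: measurable_funD; apply: measurable_funM => //.
  apply: (@measurableT_comp _ _ _ _ _ _ (fun x : 'rV[R]_n => x ord0 i) _ fst) => //.
  exact: measurable_fun_coord.
apply: (@measurableT_comp _ _ _ _ _ _ (fun x : 'rV[R]_n => x ord0 i) _ snd) => //.
exact: measurable_fun_coord.
Qed.

Lemma cons_rV_affine n (k : R) (a : 'rV[R]_n.+1) (p : R * 'rV[R]_n) :
  k *: cons_rV p + a =
  cons_rV (k * p.1 + a ord0 ord0, k *: p.2 + \row_i a ord0 (lift ord0 i)).
Proof.
apply/rowP => i; rewrite [LHS]mxE [X in X + _ = _]mxE.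
case: (unliftP ord0 i) => [j ->|->].
  by rewrite !cons_rVS !mxE.
by rewrite !cons_rV0.
Qed.

(** By induction on the dimension, slicing along the first coordinate. *)
Lemma lebesgue_rV_affine n (k : R) (a : 'rV[R]_n) (A : set 'rV[R]_n) : 0 < k ->
  measurable A ->
  lebesgue_rV n ((fun x => k *: x + a) @^-1` A) = ((k^-1 ^+ n)%:E * lebesgue_rV n A)%E.
Proof.
move=> k0; elim: n a A => [|n IHn] a A mA.
  rewrite expr0 mul1e; congr (lebesgue_rV 0 _).
  by apply/seteqP; split => x /=; rewrite thinmx0 [X in _ -> A X]thinmx0.
rewrite /= /pushforward.
pose S : set (measurableTypeR R * 'rV[R]_n) := @cons_rV R n @^-1` A.
have mS : measurable S.
  by rewrite -[S]setTI; exact: measurable_cons_rV.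
pose G (x : measurableTypeR R) := lebesgue_rV n (xsection S x).
have mG : measurable_fun setT G by exact: measurable_fun_xsection.
have G0 x : (0 <= G x)%E by exact: measure_ge0.
transitivity (\int[leb]_x ((k^-1 ^+ n)%:E * G (k * x + a ord0 ord0)%R))%E.
  apply: eq_integral => x _ /=.
  pose a' := \row_i a ord0 (lift ord0 i).
  rewrite -(IHn a'); last exact: measurable_xsection.
  congr (lebesgue_rV n _); apply/seteqP; split => y; rewrite /xsection /= !inE /=;
  by rewrite cons_rV_affine.
rewrite ge0_integralZl_EFin//; last 2 first.
- by apply: (@measurableT_comp _ _ _ _ _ _ G) => //; exact: measurable_affine1.
- by rewrite exprn_ge0// invr_ge0 ltW.
rewrite [X in (_ * X)%E](@ge0_integral_scaling _ (measurableTypeR R) R leb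
  (fun x => k * x + a ord0 ord0) k^-1 G _ _ _ mG G0).
- by rewrite muleA -EFinM -exprSr.
- by rewrite invr_ge0 ltW.
- exact: measurable_affine1.
- by move=> B mB; exact: lebesgue_measure_affine.
Qed.

Lemma integral_lebesgue_affine n (k : R) (a : 'rV[R]_n)
  (F : 'rV[R]_n -> \bar R) : 0 < k ->
  measurable_fun setT F -> (forall x, 0 <= F x)%E ->
  (\int[lebesgue_rV n]_x F (k *: x + a)%R =
   (k^-1 ^+ n)%:E * \int[lebesgue_rV n]_x F x)%E.
Proof.
move=> k0 mF F0; apply: ge0_integral_scaling => //.
- by rewrite exprn_ge0// invr_ge0 ltW.
- exact: measurable_affine.
- by move=> A mA; exact: lebesgue_rV_affine.
Qed.

(** The linear map sending [(x, x')] to the points of parameters [s < t] on the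
    segment from [x] to [x'] has determinant [(t - s) ^ n]. It is factored into
    maps that move a single variable: [x' = x + w], then [x = z - s w], then
    [w = (z' - z) / (t - s)]. *)
Lemma integral_segment n (s t : R) (F : 'rV[R]_n * 'rV[R]_n -> \bar R) :
  s < t -> measurable_fun setT F -> (forall z, 0 <= F z)%E ->
  (\int[lebesgue_rV n]_x \int[lebesgue_rV n]_x'
     F ((1 - s) *: x + s *: x', (1 - t) *: x + t *: x')%R =
   ((t - s)^-1 ^+ n)%:E * \int[lebesgue_rV n]_x \int[lebesgue_rV n]_x' F (x, x'))%E.
Proof.
move=> st mF F0; have ts0 : 0 < t - s by rewrite subr_gt0.
have mF2 (h : 'rV[R]_n -> 'rV[R]_n * 'rV[R]_n) :
    measurable_fun setT h -> measurable_fun setT (F \o h).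
  by move=> mh; exact: measurableT_comp.
pose H (z : 'rV[R]_n * 'rV[R]_n) := F (1 *: z.1 + s *: z.2, 1 *: z.1 + t *: z.2).
have mH : measurable_fun setT H.
  apply: measurableT_comp => //; apply: measurable_fun_pair;
  exact: measurable_lincomb.
have H0 z : (0 <= H z)%E by exact: F0.
transitivity (\int[lebesgue_rV n]_x \int[lebesgue_rV n]_w H (x, w))%E.
  apply: eq_integral => x _.
  have mHx : measurable_fun setT (fun w => H (x, w)).
    by apply: measurableT_comp => //; exact: pair1_measurable.
  have := integral_lebesgue_affine (- x) ltr01 mHx (fun=> H0 _).
  rewrite invr1 expr1n mul1e => <-; apply: eq_integral => x' _; rewrite /H /=.
  congr (F (_, _)); apply/rowP => i; rewrite !mxE; ring.
rewrite fubini_tonelli//.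
pose K (z : 'rV[R]_n * 'rV[R]_n) := F (z.1, 1 *: z.1 + (t - s) *: z.2).
have mK : measurable_fun setT K.
  apply: measurableT_comp => //; apply: measurable_fun_pair => //.
  exact: measurable_lincomb.
have K0 z : (0 <= K z)%E by exact: F0.
transitivity (\int[lebesgue_rV n]_w \int[lebesgue_rV n]_x K (x, w))%E.
  apply: eq_integral => w _.
  have mKw : measurable_fun setT (fun x => K (x, w)).
    by apply: measurableT_comp => //; exact: pair2_measurable.
  have := integral_lebesgue_affine (s *: w) ltr01 mKw (fun=> K0 _).
  rewrite invr1 expr1n mul1e => <-; apply: eq_integral => x _; rewrite /H /K /=.
  congr (F (_, _)); apply/rowP => i; rewrite !mxE; ring.
rewrite -fubini_tonelli// -ge0_integralZl_EFin//; last 3 first.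
- by move=> x _; apply: integral_ge0.
- exact: measurable_fun_fubini_tonelli_F.
- by rewrite exprn_ge0// invr_ge0 ltW.
apply: eq_integral => x _.
have mFx : measurable_fun setT (fun x' => F (x, x')).
  by apply: measurableT_comp => //; exact: pair1_measurable.
rewrite -(integral_lebesgue_affine x ts0 mFx)//.
by apply: eq_integral => w _; rewrite /K /= scale1r addrC.
Qed.

End lebesgue_affine.

(** * A Poincare inequality with localized differences *)

Lemma sqr_sum_le (R : realFieldType) n (a : 'I_n -> R) :
  (\sum_i a i) ^+ 2 <= n%:R * \sum_i a i ^+ 2.
Proof.
have -> : n%:R * (\sum_i a i ^+ 2) = \sum_i \sum_j (a i ^+ 2 / 2 + a j ^+ 2 / 2).
  under [RHS]eq_bigr => i _ do rewrite big_split /= sumr_const card_ord -mulr_suml.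
  rewrite big_split /= sumr_const card_ord sumrMnl -mulr_suml.
  by move: (\sum_i _) => S; rewrite -(mulr_natl (S / 2)); lra.
rewrite expr2 mulr_suml; apply: ler_sum => i _; rewrite mulr_sumr.
by apply: ler_sum => j _; have := sqr_ge0 (a i - a j); lra.
Qed.

Section density_comparison.
Context (R : realType) (d : nat) (P : probability 'rV[R]_d R)
  (rho : 'rV[R]_d -> R) (Omega : set 'rV[R]_d) (lam Lam : R).
Hypotheses (fO : full P Omega) (Prho : has_density P rho)
  (lam_ge0 : 0 <= lam) (Lam_ge0 : 0 <= Lam)
  (rhoB : forall x, Omega x -> lam <= rho x <= Lam).
Local Notation V := 'rV[R]_d.
Local Notation leb := (@lebesgue_rV R d).

Lemma density_measure_bounds (A : set V) : measurable A -> A `<=` Omega ->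
  (lam%:E * leb A <= P A <= Lam%:E * leb A)%E.
Proof.
move=> mA AO; case: Prho => mrho rho0 ->//.
rewrite -!integral_cst//; apply/andP; split; apply: ge0_le_integral => //.
- by apply/measurable_EFinP; exact: measurable_funTS.
- by move=> x /AO/rhoB/andP[+ _]; rewrite lee_fin.
- by move=> x _; rewrite lee_fin.
- by apply/measurable_EFinP; exact: measurable_funTS.
- by move=> x /AO/rhoB/andP[_]; rewrite lee_fin.
Qed.

Let mO : measurable Omega. Proof. by case: fO. Qed.

Lemma integral_indicE (mu : {measure set V -> \bar R}) (F : V -> \bar R) :
  (\int[mu]_(x in Omega) F x = \int[mu]_x ((\1_Omega x)%:E * F x))%E.
Proof.
rewrite integral_mkcond; apply: eq_integral => x _; rewrite patchE indicE.
by case: ifP => _; rewrite ?mul1e ?mul0e.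
Qed.

Lemma density_integral_le (F : V -> \bar R) : measurable_fun setT F ->
  (forall x, 0 <= F x)%E ->
  (\int[P]_x F x <= Lam%:E * \int[leb]_x ((\1_Omega x)%:E * F x))%E.
Proof.
move=> mF F0; rewrite -integral_indicE.
rewrite (@ge0_negligible_integral _ _ _ P setT (~` Omega)) ?setTD ?setCK//;
  [|exact: measurableC|exact: full_setC fO].
pose m : {measure set V -> \bar R} :=
  mscale (NngNum Lam_ge0) (mrestr leb mO).
apply: (@le_trans _ _ (\int[m]_(x in Omega) F x)%E); last first.
  rewrite [leLHS]ge0_integral_mscale//; last exact: measurable_funTS.
  rewrite (@eq_measure_integral _ _ _ Omega leb)// => A mA AO /=.
  by rewrite /mrestr (setIidl AO).
rewrite (@eq_measure_integral _ _ _ Omega (mrestr P mO)); last first.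
  by move=> A mA AO; rewrite /= /mrestr (setIidl AO).
apply: ge0_le_measure_integral => // A mA; rewrite /m /= /mscale /mrestr /=.
have mAO : measurable (A `&` Omega) by exact: measurableI.
by have /andP[_] := density_measure_bounds mAO (@subIsetr _ A Omega).
Qed.

Lemma density_integral_ge (F : V -> \bar R) : measurable_fun setT F ->
  (forall x, 0 <= F x)%E ->
  (lam%:E * \int[leb]_x ((\1_Omega x)%:E * F x) <= \int[P]_x F x)%E.
Proof.
move=> mF F0; rewrite -integral_indicE.
rewrite [leRHS](@ge0_negligible_integral _ _ _ P setT (~` Omega)) ?setTD ?setCK//;
  [|exact: measurableC|exact: full_setC fO].
pose m : {measure set V -> \bar R} :=
  mscale (NngNum lam_ge0) (mrestr leb mO).
apply: (@le_trans _ _ (\int[m]_(x in Omega) F x)%E).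
  rewrite [leRHS]ge0_integral_mscale//; last exact: measurable_funTS.
  rewrite [in leRHS](@eq_measure_integral _ _ _ Omega leb)// => A mA AO /=.
  by rewrite /mrestr (setIidl AO).
rewrite [leRHS](@eq_measure_integral _ _ _ Omega (mrestr P mO)); last first.
  by move=> A mA AO; rewrite /= /mrestr (setIidl AO).
apply: ge0_le_measure_integral => // A mA; rewrite /m /= /mscale /mrestr /=.
have mAO : measurable (A `&` Omega) by exact: measurableI.
by have /andP[] := density_measure_bounds mAO (@subIsetr _ A Omega).
Qed.

(** [F] restricted to [Omega x Omega] and extended by zero. *)
Definition cut2 (F : V * V -> \bar R) (z : V * V) : \bar R :=
  ((\1_Omega z.1)%:E * ((\1_Omega z.2)%:E * F z))%E.

Section two_variables.
Variable F : V * V -> \bar R.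
Hypotheses (mF : measurable_fun setT F) (F0 : forall z, (0 <= F z)%E).

Let ind0 x : (0 <= (\1_Omega x : R)%:E)%E. Proof. by rewrite lee_fin. Qed.

Let mind : measurable_fun setT (fun x : V => (\1_Omega x : R)%:E).
Proof. by apply/measurable_EFinP; exact: measurable_indic. Qed.

Let F1 (z : V * V) : \bar R := ((\1_Omega z.2 : R)%:E * F z)%E.

Let mF1 : measurable_fun setT F1.
Proof.
apply: emeasurable_funM => //.
by apply: (@measurableT_comp _ _ _ _ _ _ (fun x : V => (\1_Omega x : R)%:E) _ snd).
Qed.

Let F10 z : (0 <= F1 z)%E. Proof. exact: mule_ge0. Qed.

Lemma measurable_cut2 : measurable_fun setT (cut2 F).
Proof.
apply: emeasurable_funM => //.
by apply: (@measurableT_comp _ _ _ _ _ _ (fun x : V => (\1_Omega x : R)%:E) _ fst).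
Qed.

Lemma cut2_ge0 z : (0 <= cut2 F z)%E.
Proof. by apply: mule_ge0; last exact: F10. Qed.

Let cut2E : (\int[leb]_x ((\1_Omega x)%:E * \int[leb]_x' F1 (x, x')) =
  \int[leb]_x \int[leb]_x' cut2 F (x, x'))%E.
Proof.
apply: eq_integral => x _; rewrite -ge0_integralZl_EFin//.
by apply: measurableT_comp => //; exact: pair1_measurable.
Qed.

Let mint1 : measurable_fun setT (fun x => \int[leb]_x' F1 (x, x'))%E.
Proof. exact: measurable_fun_fubini_tonelli_F. Qed.

Lemma density_integral2_le : (\int[P]_x \int[P]_x' F (x, x') <=
  (Lam ^+ 2)%:E * \int[leb]_x \int[leb]_x' cut2 F (x, x'))%E.
Proof.
apply: (@le_trans _ _ (\int[P]_x (Lam%:E * \int[leb]_x' F1 (x, x')))%E).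
  apply: ge0_le_integral => //.
  - by move=> x _; apply: integral_ge0.
  - exact: measurable_fun_fubini_tonelli_F.
  - exact: emeasurable_funM.
  - move=> x _; apply: density_integral_le => //.
    by apply: measurableT_comp => //; exact: pair1_measurable.
rewrite ge0_integralZl_EFin//; last by move=> x _; apply: integral_ge0.
rewrite expr2 EFinM -muleA -cut2E lee_wpmul2l ?lee_fin//.
by apply: density_integral_le => // x; apply: integral_ge0.
Qed.

Lemma density_integral2_ge :
  ((lam ^+ 2)%:E * \int[leb]_x \int[leb]_x' cut2 F (x, x') <=
   \int[P]_x \int[P]_x' F (x, x'))%E.
Proof.
apply: (@le_trans _ _ (\int[P]_x (lam%:E * \int[leb]_x' F1 (x, x')))%E); last first.
  apply: ge0_le_integral => //.
  - by move=> x _; apply: mule_ge0 => //; apply: integral_ge0.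
  - exact: emeasurable_funM.
  - exact: measurable_fun_fubini_tonelli_F.
  - move=> x _; apply: density_integral_ge => //.
    by apply: measurableT_comp => //; exact: pair1_measurable.
rewrite [leRHS]ge0_integralZl_EFin//; last by move=> x _; apply: integral_ge0.
rewrite expr2 EFinM -muleA -cut2E lee_wpmul2l ?lee_fin//.
by apply: density_integral_ge => // x; apply: integral_ge0.
Qed.

End two_variables.
End density_comparison.

Section local_poincare.
Context (R : realType) (d : nat) (P : probability 'rV[R]_d R)
  (rho : 'rV[R]_d -> R) (Omega : set 'rV[R]_d) (lam Lam : R).
Hypotheses (fO : full P Omega) (Prho : has_density P rho)
  (cO : convex_set Omega) (lam_gt0 : 0 < lam) (Lam_ge0 : 0 <= Lam)
  (rhoB : forall x, Omega x -> lam <= rho x <= Lam).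
Local Notation V := 'rV[R]_d.
Local Notation leb := (@lebesgue_rV R d).

Lemma convex_segment x x' (s : R) : Omega x -> Omega x' -> 0 <= s -> s <= 1 ->
  Omega ((1 - s) *: x + s *: x').
Proof.
move=> Ox Ox' s0 s1; have := @cO x' x (Itv01 s0 s1).
by rewrite !inE => /(_ Ox' Ox); rewrite /conv/= addrC.
Qed.

(** The pairs of points of [Omega] at distance at most [r]. *)
Definition near_pairs (r : R) : set (V * V) :=
  [set z | [/\ Omega z.1, Omega z.2 & enorm (z.1 - z.2) <= r]].

(** The squared increment of [u], restricted to nearby pairs. *)
Definition near_diff (r : R) (u : V -> R) (z : V * V) : R :=
  \1_(near_pairs r) z * (u z.1 - u z.2) ^+ 2.

Lemma measurable_near_pairs r : measurable (near_pairs r).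
Proof.
have [mO _] := fO.
rewrite (_ : near_pairs r = (Omega `*` Omega) `&`
    ((fun z : V * V => enorm (1 *: z.1 + (-1) *: z.2)) @^-1` `]-oo, r])).
  apply: measurableI; first exact: measurableX.
  rewrite -[X in measurable X]setTI.
  apply: (@measurableT_comp _ _ _ _ _ _ (@enorm R d)) => //.
    exact: measurable_enorm.
  exact: measurable_lincomb.
apply/seteqP; split => [z [z1 z2 zr]|z [[z1 z2]]] /=.
  by split => //; rewrite in_itv/= scale1r scaleN1r.
by rewrite in_itv/= scale1r scaleN1r => zr; split.
Qed.

Lemma near_diff_ge0 r u z : 0 <= near_diff r u z.
Proof. by rewrite mulr_ge0// sqr_ge0. Qed.

Lemma measurable_sqr_diff (u : V -> R) : measurable_fun setT u ->
  measurable_fun setT (fun z : V * V => (u z.1 - u z.2) ^+ 2).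
Proof.
by move=> mu; apply: measurable_funX; apply: measurable_funB; exact: measurableT_comp.
Qed.

Lemma measurable_near_diff r (u : V -> R) : measurable_fun setT u ->
  measurable_fun setT (near_diff r u).
Proof.
move=> mu; apply: measurable_funM; last exact: measurable_sqr_diff.
by apply: measurable_indic; exact: measurable_near_pairs.
Qed.

(** Differences across [Omega] are split along segments into [N] steps of length
    at most [r]. *)
Lemma sqr_diff_segment (u : V -> R) (N : nat) (r : R) x x' : (0 < N)%N ->
  Omega x -> Omega x' -> enorm (x - x') <= N%:R * r ->
  (u x - u x') ^+ 2 <= N%:R * \sum_(i < N) near_diff r u
    ((1 - i%:R / N%:R) *: x + (i%:R / N%:R) *: x',
     (1 - i.+1%:R / N%:R) *: x + (i.+1%:R / N%:R) *: x').
Proof.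
move=> N0 Ox Ox' xx'.
have NR0 : 0 < N%:R :> R by rewrite ltr0n.
pose z i : V := (1 - i%:R / N%:R) *: x + (i%:R / N%:R) *: x'.
have -> : u x - u x' = \sum_(i < N) (u (z i) - u (z i.+1)).
  have -> K : \sum_(i < K) (u (z i) - u (z i.+1)) = u (z 0%N) - u (z K).
    elim: K => [|K IHK]; first by rewrite big_ord0 subrr.
    by rewrite big_ord_recr IHK /= addrA subrK.
  rewrite /z mul0r subr0 scale1r scale0r addr0.
  by rewrite divff ?gt_eqF// subrr scale0r scale1r add0r.
apply: le_trans (sqr_sum_le _) _; rewrite ler_wpM2l//.
apply: ler_sum => i _; rewrite /near_diff -/(z i) -/(z i.+1) /=.
rewrite indicE mem_set ?mul1r//=; split => /=.
- apply: convex_segment => //.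
  by rewrite ler_pdivrMr// mul1r ler_nat ltnW.
- apply: convex_segment => //.
  by rewrite ler_pdivrMr// mul1r ler_nat.
have -> : z i - z i.+1 = N%:R^-1 *: (x - x').
  by apply/rowP => j; rewrite !mxE -natr1; field; rewrite gt_eqF.
by rewrite enormZ ?invr_ge0// mulrC ler_pdivrMr// mulrC.
Qed.

(** Differences over [Omega x Omega] are controlled by differences at distance at
    most [r]. Bounding by segments costs a factor [N] for the square of a sum,
    a factor [N] for the number of terms, and [N ^ d] for the Jacobian of the map
    from end points to consecutive points; passing between [P] and Lebesgue
    measure costs [Lam ^ 2 / lam ^ 2]. *)
Theorem local_poincare (u : V -> R) (N : nat) (r : R) : (0 < N)%N ->
  measurable_fun setT u ->
  (forall x x', Omega x -> Omega x' -> enorm (x - x') <= N%:R * r) ->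
  (\int[P]_x \int[P]_x' ((u x - u x') ^+ 2)%:E <=
   (Lam ^+ 2 / lam ^+ 2 * N%:R ^+ (d + 2))%:E *
   \int[P]_x \int[P]_x' (near_diff r u (x, x'))%:E)%E.
Proof.
move=> N0 mu diam.
have NR0 : 0 < N%:R :> R by rewrite ltr0n.
pose J (z : V * V) := ((u z.1 - u z.2) ^+ 2)%:E.
pose G (z : V * V) := (near_diff r u z)%:E.
have mJ : measurable_fun setT J by apply/measurable_EFinP; exact: measurable_sqr_diff.
have mG : measurable_fun setT G by apply/measurable_EFinP; exact: measurable_near_diff.
have J0 z : (0 <= J z)%E by rewrite lee_fin sqr_ge0.
have G0 z : (0 <= G z)%E by rewrite lee_fin near_diff_ge0.
have lam_ge0 := ltW lam_gt0.
have h1 := density_integral2_le fO Prho lam_ge0 Lam_ge0 rhoB mJ J0.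
apply: (le_trans h1) => {h1}.
have cutG : cut2 Omega G = G.
  apply/funext => z; rewrite /cut2 /G /near_diff !indicE.
  case: (boolP (z \in near_pairs r)) => [|_]; last by rewrite !mul0r !mule0.
  by rewrite inE => -[z1 z2 _]; rewrite !mem_set// !mul1e.
have step2 : (\int[leb]_x \int[leb]_x' cut2 Omega J (x, x') <=
    (N%:R ^+ (d + 2))%:E * \int[leb]_x \int[leb]_x' G (x, x'))%E.
  pose s (i : nat) : R := i%:R / N%:R.
  pose W (i : nat) (z : V * V) : \bar R :=
    G ((1 - s i) *: z.1 + s i *: z.2, (1 - s i.+1) *: z.1 + s i.+1 *: z.2).
  have mW i : measurable_fun setT (W i).
    apply: measurableT_comp => //; apply: measurable_fun_pair;
    exact: measurable_lincomb.
  have W0 i z : (0 <= W i z)%E by exact: G0.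
  have IW i : (\int[leb]_x \int[leb]_x' W i (x, x') =
      (N%:R ^+ d)%:E * \int[leb]_x \int[leb]_x' G (x, x'))%E.
    have ss : s i < s i.+1 by rewrite ltr_pM2r ?invr_gt0// ltr_nat.
    rewrite (integral_segment ss mG G0); congr (_%:E * _)%E; congr (_ ^+ d).
    by rewrite /s -mulrBl -natr1 addrAC subrr add0r mul1r invrK.
  have mWx i x : measurable_fun setT (fun x' => W i (x, x')).
    by apply: measurableT_comp => //; exact: pair1_measurable.
  have mIW i : measurable_fun setT (fun x => \int[leb]_x' W i (x, x'))%E.
    exact: measurable_fun_fubini_tonelli_F.
  apply: (@le_trans _ _ (\int[leb]_x \int[leb]_x'
      (N%:R%:E * \sum_(i < N) W i (x, x')))%E).
    have mS : measurable_fun setT (fun z => N%:R%:E * \sum_(i < N) W i z)%E.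
      by apply: emeasurable_funM => //; exact: emeasurable_sum.
    have S0 z : (0 <= N%:R%:E * \sum_(i < N) W i z)%E.
      by rewrite mule_ge0// sume_ge0.
    have cJ0 := cut2_ge0 Omega J0.
    have mcJ := measurable_cut2 fO mJ.
    apply: ge0_le_integral => //.
    - by move=> x _; apply: integral_ge0.
    - exact: measurable_fun_fubini_tonelli_F.
    - exact: (measurable_fun_fubini_tonelli_F _ mS S0).
    move=> x _; apply: ge0_le_integral => //.
    - by apply: measurableT_comp => //; exact: pair1_measurable.
    - by apply: (@measurableT_comp _ _ _ _ _ _ _ _ _ mS); exact: pair1_measurable.
    move=> x' _; rewrite /cut2 /= !indicE.
    have [xO|nx] := boolP (x \in Omega); last by rewrite mul0e S0.
    have [x'O|nx'] := boolP (x' \in Omega); last by rewrite mul0e mule0 S0.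
    rewrite !mul1e /W /G /J /= sumEFin -EFinM lee_fin.
    move: xO x'O; rewrite !inE => xO x'O.
    by apply: sqr_diff_segment => //; exact: diam.
  under eq_integral => x _.
    rewrite ge0_integralZl_EFin//; last 2 first.
    - by move=> x' _; rewrite sume_ge0.
    - exact: emeasurable_sum.
    rewrite ge0_integral_sum//; over.
  rewrite ge0_integralZl_EFin//; last 2 first.
  - by move=> x _; rewrite sume_ge0// => i _; apply: integral_ge0.
  - exact: emeasurable_sum.
  rewrite ge0_integral_sum//; last by move=> i x _; apply: integral_ge0.
  under eq_bigr do rewrite IW.
  rewrite -ge0_sume_distrl//.
  rewrite sumEFin sumr_const card_ord muleA -EFinM -[X in _ * X]mulr_natl.
  by rewrite -!exprS addn2.
apply: le_trans (lee_wpmul2l _ step2) _; first by rewrite lee_fin sqr_ge0.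
have := density_integral2_ge fO Prho lam_ge0 rhoB mG G0; rewrite cutG => h.
have c0 : (0 <= (Lam ^+ 2 / lam ^+ 2 * N%:R ^+ (d + 2))%:E)%E.
  by rewrite lee_fin mulr_ge0 ?exprn_ge0// divr_ge0// sqr_ge0.
apply: le_trans (lee_wpmul2l c0 h).
rewrite !muleA -!EFinM le_eqVlt; apply/orP; left; apply/eqP; congr (_%:E * _)%E.
by field; rewrite gt_eqF.
Qed.

End local_poincare.

(** * The dual objective and its gradient *)

Section Lnorm2.
Context d (T : measurableType d) (R : realType).

Lemma poweR_sqr (x : \bar R) : (0 <= x)%E -> (x `^ 2 = x ^+ 2)%E.
Proof.
case: x => [r r0| _|//]; last by rewrite poweRyr// expe2 mulyy.
by rewrite poweR_EFin powR_mulrn// EFin_expe.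
Qed.

Lemma Lnorm2_sqr (mu : {measure set T -> \bar R}) (h : T -> \bar R) :
  ('N[mu]_2%:E[h] ^+ 2 = \int[mu]_x (`|h x| ^+ 2))%E.
Proof.
rewrite -poweR_sqr ?Lnorm_ge0// poweR_Lnorm//.
by apply: eq_integral => x _; rewrite poweR_sqr.
Qed.

Lemma Lnorm2_sqr_bm (mu : probability T R) (A : set T) (f : T -> R) :
  full mu A -> bmfun A f ->
  ('N[mu]_2%:E[EFin \o f] ^+ 2 = (\int[mu]_x f x ^+ 2)%:E)%E.
Proof.
move=> fA bf; rewrite Lnorm2_sqr -(integral_bmE fA); last by bm.
apply: eq_integral => x _ /=.
by rewrite -EFinM -expr2 -normrX ger0_norm ?sqr_ge0.
Qed.

Lemma bm_Lfun2 (mu : probability T R) (A : set T) (f : T -> R) :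
  full mu A -> bmfun A f -> f \in Lfun mu 2%:E.
Proof.
move=> fA bf; rewrite inE; apply/andP; split; first by rewrite inE; case: bf.
rewrite inE /= /finite_norm; apply: (@lty_poweRy _ _ 2) => //.
by rewrite poweR_sqr ?Lnorm_ge0// (Lnorm2_sqr_bm fA bf) ltry.
Qed.

End Lnorm2.

Section positive_part.
Context (R : realFieldType).
Implicit Types a b h : R.

Lemma pos_sqr_ge a h :
  Num.max a 0 ^+ 2 + 2 * h * Num.max a 0 <= Num.max (a + h) 0 ^+ 2.
Proof. by case: (leP a 0) => ha; case: (leP (a + h) 0) => hb; nra. Qed.

Lemma pos_sqr_le a h :
  Num.max (a + h) 0 ^+ 2 <= Num.max a 0 ^+ 2 + 2 * h * Num.max a 0 + h ^+ 2.
Proof. by case: (leP a 0) => ha; case: (leP (a + h) 0) => hb; nra. Qed.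

Lemma pos_diff_le a b : `|Num.max a 0 - Num.max b 0| <= `|a - b|.
Proof.
by rewrite !ler_norml; have := ler_norm (a - b); have := ler_norm (b - a);
   rewrite (distrC b a); move: `|a - b| => t h1 h2; case: (leP a 0) => ha;
   case: (leP b 0) => hb; lra.
Qed.

End positive_part.

Section dual.
Context (R : realType) (d : nat).
Local Notation V := 'rV[R]_d.
Variables (P Q : probability V R) (Omega Omega' : set V) (c : V -> V -> R)
  (eps : R).
Hypotheses (fA : full P Omega) (fB : full Q Omega') (eps_gt0 : 0 < eps)
  (bc : bmfun (Omega `*` Omega') (fun z => c z.1 z.2)).
Local Notation PQ := (prod_prob P Q).
Local Notation D1 := (D1Gam Q c eps).
Local Notation D2 := (D2Gam P c eps).
Implicit Types f g phi psi : V -> R.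

Lemma full_prod_prob : full PQ (Omega `*` Omega').
Proof. exact: full_prod. Qed.

Section bounded_potentials.
Variables f g : V -> R.
Hypotheses (bf : bmfun Omega f) (bg : bmfun Omega' g).

Let bf1 := bm_fst Omega' bf.
Let bg2 := bm_snd Omega bg.

Lemma bm_excess : bmfun (Omega `*` Omega') (fun z => excess c f g z.1 z.2).
Proof. by rewrite /excess; bm. Qed.

Lemma bm_D1 : bmfun Omega (D1 f g).
Proof. by rewrite /D1Gam; bm; exact: (bm_Rint2 fB bm_excess). Qed.

Lemma bm_D2 : bmfun Omega' (D2 f g).
Proof. by rewrite /D2Gam; bm; exact: (bm_Rint1 fA bm_excess). Qed.

(** [D1Gam] and [D2Gam] represent the derivative of [Gam]. *)
Lemma gradient_pairing phi psi : bmfun Omega phi -> bmfun Omega' psi ->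
  \int[PQ]_z ((phi z.1 + psi z.2) * (1 - eps^-1 * excess c f g z.1 z.2)) =
  \int[P]_x (phi x * D1 f g x) + \int[Q]_y (psi y * D2 f g y).
Proof.
move=> bphi bpsi; have be := bm_excess.
have bphi1 := bm_fst Omega' bphi; have bpsi2 := bm_snd Omega bpsi.
rewrite (_ : \int[PQ]_z _ = \int[PQ]_z
   (phi z.1 * (1 - eps^-1 * excess c f g z.1 z.2) +
    psi z.2 * (1 - eps^-1 * excess c f g z.1 z.2))); last first.
  by apply: eq_Rintegral => z _; rewrite mulrDl.
rewrite (RintD full_prod_prob); [|bm|bm].
congr (_ + _).
  rewrite (Rint_prod12 fA fB); last by bm.
  apply: (Rint_eq fA); [|have b1 := bm_D1; bm|].
    by apply: (bm_Rint2 fB (F := fun z => phi z.1 * (1 - eps^-1 * excess c f g z.1 z.2))); bm.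
  move=> x Ox /=; have bx := bm_pair1 Ox be.
  rewrite (RintZ fB); last by bm.
  by rewrite (RintB fB) ?(Rint_cst)// ?(RintZ fB)//; bm.
rewrite (Rint_prod21 fA fB); last by bm.
apply: (Rint_eq fB); [|have b2 := bm_D2; bm|].
  by apply: (bm_Rint1 fA (F := fun z => psi z.2 * (1 - eps^-1 * excess c f g z.1 z.2))); bm.
move=> y Oy /=; have by_ := bm_pair2 Oy be.
rewrite (RintZ fA); last by bm.
by rewrite (RintB fA) ?(Rint_cst)// ?(RintZ fA)//; bm.
Qed.

Variables phi psi : V -> R.
Hypotheses (bphi : bmfun Omega phi) (bpsi : bmfun Omega' psi).
Let bphi1 := bm_fst Omega' bphi.
Let bpsi2 := bm_snd Omega bpsi.

Let f' x := f x + phi x.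
Let g' y := g y + psi y.

(** Concavity of [Gam]: its graph lies below its tangents. *)
Lemma Gam_le_tangent :
  Gam P Q c eps f' g' <= Gam P Q c eps f g +
    (\int[P]_x (phi x * D1 f g x) + \int[Q]_y (psi y * D2 f g y)).
Proof.
have be := bm_excess.
have be' : bmfun (Omega `*` Omega') (fun z => excess c f' g' z.1 z.2).
  by rewrite /excess /f' /g'; bm.
rewrite -gradient_pairing// -(RintD full_prod_prob); [|bm|bm].
apply: (Rint_le full_prod_prob); [rewrite /f' /g'; bm|bm|].
move=> [x y] _ /=; rewrite /f' /g' /excess.
have := pos_sqr_ge (f x + g y - c x y) (phi x + psi y).
have -> : f x + g y - c x y + (phi x + psi y) = f x + phi x + (g y + psi y) - c x y by ring.
set b := Num.max _ _; set b' := Num.max _ _ => h.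
rewrite -subr_ge0.
have -> : f x + g y - (2 * eps)^-1 * b ^+ 2 + (phi x + psi y) * (1 - eps^-1 * b) -
   (f x + phi x + (g y + psi y) - (2 * eps)^-1 * b' ^+ 2) =
   (2 * eps)^-1 * (b' ^+ 2 - (b ^+ 2 + 2 * (phi x + psi y) * b)).
  by field; rewrite gt_eqF.
by rewrite mulr_ge0 ?subr_ge0// invr_ge0 mulr_ge0// ltW.
Qed.

(** Smoothness of [Gam]: its second derivative in the direction [(phi, psi)] is at
    most the squared norm of [phi + psi], divided by [eps]. *)
Lemma Gam_ge_quadratic :
  Gam P Q c eps f g +
    (\int[P]_x (phi x * D1 f g x) + \int[Q]_y (psi y * D2 f g y)) -
    (2 * eps)^-1 * \int[PQ]_z (phi z.1 + psi z.2) ^+ 2 <= Gam P Q c eps f' g'.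
Proof.
have be := bm_excess.
have be' : bmfun (Omega `*` Omega') (fun z => excess c f' g' z.1 z.2).
  by rewrite /excess /f' /g'; bm.
rewrite -gradient_pairing// -(RintD full_prod_prob); [|bm|bm].
rewrite -(RintZ full_prod_prob); last by bm.
rewrite -(RintB full_prod_prob); [|bm|bm].
apply: (Rint_le full_prod_prob); [bm|rewrite /f' /g'; bm|].
move=> [x y] _ /=; rewrite /f' /g' /excess.
have := pos_sqr_le (f x + g y - c x y) (phi x + psi y).
have -> : f x + g y - c x y + (phi x + psi y) = f x + phi x + (g y + psi y) - c x y by ring.
set b' := Num.max _ _; set b := Num.max _ _ => h.
rewrite -subr_ge0.
have -> : f x + phi x + (g y + psi y) - (2 * eps)^-1 * b' ^+ 2 -
   (f x + g y - (2 * eps)^-1 * b ^+ 2 + (phi x + psi y) * (1 - eps^-1 * b) -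
    (2 * eps)^-1 * (phi x + psi y) ^+ 2) =
   (2 * eps)^-1 * ((b ^+ 2 + 2 * (phi x + psi y) * b + (phi x + psi y) ^+ 2) - b' ^+ 2).
  by field; rewrite gt_eqF.
by rewrite mulr_ge0 ?subr_ge0// invr_ge0 mulr_ge0// ltW.
Qed.

End bounded_potentials.

Section maximizer.
Variables fs gs : V -> R.
Hypotheses (bfs : bmfun Omega fs) (bgs : bmfun Omega' gs)
  (maxi : dual_maximizer P Q c eps fs gs).

(** Otherwise a step of length [eps] along [D1Gam] would increase [Gam]. *)
Lemma maximizer_D1_ae : P (Omega `&` [set x | D1 fs gs x != 0]) = 0%E.
Proof.
have b1 := bm_D1 bfs bgs.
have bphi : bmfun Omega (fun x => eps * D1 fs gs x) by bm.
have bpsi : bmfun Omega' (fun=> 0 : R) by bm.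
have := Gam_ge_quadratic bfs bgs bphi bpsi.
have [_ _ /(_ (fun x => fs x + eps * D1 fs gs x) (fun y => gs y + 0))] := maxi.
rewrite (bm_Lfun2 fA)/=; last by bm.
rewrite (bm_Lfun2 fB)/=; last by bm.
move=> /(_ isT isT) h1 h2; have {h1 h2} := le_trans h2 h1.
have -> : \int[Q]_y (0 * D2 fs gs y) = 0.
  by rewrite -[RHS](Rint_cst Q); apply: eq_Rintegral => y _; rewrite mul0r.
have -> : \int[P]_x (eps * D1 fs gs x * D1 fs gs x) = eps * \int[P]_x D1 fs gs x ^+ 2.
  by rewrite -(RintZ fA); [apply: eq_Rintegral => x _; rewrite mulrA|bm].
have -> : \int[PQ]_z (eps * D1 fs gs z.1 + 0) ^+ 2 = eps ^+ 2 * \int[P]_x D1 fs gs x ^+ 2.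
  have b11 := bm_fst Omega' b1.
  rewrite (Rint_prod12 fA fB); last by bm.
  rewrite -(RintZ fA); last by bm.
  by apply: eq_Rintegral => x _ /=; rewrite Rint_cst addr0 exprMn.
move=> h.
have I0 : \int[P]_x D1 fs gs x ^+ 2 = 0.
  apply/eqP; rewrite eq_le; apply/andP; split; last first.
    by apply: (Rint_ge fA) => [|x _]; [bm|exact: sqr_ge0].
  move: h; set I := \int[P]_x _; rewrite addr0.
  have -> : (2 * eps)^-1 * (eps ^+ 2 * I) = eps * I / 2 by field; rewrite gt_eqF.
  by move=> h; rewrite -(pmulr_rle0 _ eps_gt0); lra.
have := Rint_eq0 fA _ _ I0 => <-; last 2 first.
- by bm.
- by move=> x _; exact: sqr_ge0.
congr (P _); apply/seteqP; split => x [Ox /=] h0; split => //=;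
by move: h0; rewrite sqrf_eq0.
Qed.

Lemma maximizer_D2_ae : Q (Omega' `&` [set y | D2 fs gs y != 0]) = 0%E.
Proof.
have b2 := bm_D2 bfs bgs.
have bphi : bmfun Omega (fun=> 0 : R) by bm.
have bpsi : bmfun Omega' (fun y => eps * D2 fs gs y) by bm.
have := Gam_ge_quadratic bfs bgs bphi bpsi.
have [_ _ /(_ (fun x => fs x + 0) (fun y => gs y + eps * D2 fs gs y))] := maxi.
rewrite (bm_Lfun2 fA)/=; last by bm.
rewrite (bm_Lfun2 fB)/=; last by bm.
move=> /(_ isT isT) h1 h2; have {h1 h2} := le_trans h2 h1.
have -> : \int[P]_x (0 * D1 fs gs x) = 0.
  by rewrite -[RHS](Rint_cst P); apply: eq_Rintegral => y _; rewrite mul0r.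
have -> : \int[Q]_y (eps * D2 fs gs y * D2 fs gs y) = eps * \int[Q]_y D2 fs gs y ^+ 2.
  by rewrite -(RintZ fB); [apply: eq_Rintegral => x _; rewrite mulrA|bm].
have -> : \int[PQ]_z (0 + eps * D2 fs gs z.2) ^+ 2 = eps ^+ 2 * \int[Q]_y D2 fs gs y ^+ 2.
  have b22 := bm_snd Omega b2.
  rewrite (Rint_prod21 fA fB); last by bm.
  rewrite -(RintZ fB); last by bm.
  by apply: eq_Rintegral => x _ /=; rewrite Rint_cst add0r exprMn.
move=> h.
have I0 : \int[Q]_y D2 fs gs y ^+ 2 = 0.
  apply/eqP; rewrite eq_le; apply/andP; split; last first.
    by apply: (Rint_ge fB) => [|x _]; [bm|exact: sqr_ge0].
  move: h; set I := \int[Q]_y _; rewrite add0r.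
  have -> : (2 * eps)^-1 * (eps ^+ 2 * I) = eps * I / 2 by field; rewrite gt_eqF.
  by move=> h; rewrite -(pmulr_rle0 _ eps_gt0); lra.
have := Rint_eq0 fB _ _ I0 => <-; last 2 first.
- by bm.
- by move=> x _; exact: sqr_ge0.
congr (Q _); apply/seteqP; split => x [Ox /=] h0; split => //=;
by move: h0; rewrite sqrf_eq0.
Qed.

End maximizer.
End dual.

(** A Lipschitz integrand makes [D1Gam] Lipschitz, so that it vanishes on the
    whole support as soon as it vanishes almost surely. *)
Lemma D1Gam_eq0 (R : realType) (d : nat) (P Q : probability 'rV[R]_d R)
  (Omega' : set 'rV[R]_d) (c : 'rV[R]_d -> 'rV[R]_d -> R) (eps L : R) f g :
  compact (msupport P) -> full Q Omega' -> 0 < eps -> 0 < L ->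
  bmfun (msupport P `*` Omega') (fun z => c z.1 z.2) ->
  bmfun (msupport P) f -> bmfun Omega' g ->
  (forall x x' y, `|c x y - c x' y| <= L * enorm (x - x')) ->
  elipschitz L (msupport P) f ->
  P (msupport P `&` [set x | D1Gam Q c eps f g x != 0]) = 0%E ->
  forall x, msupport P x -> D1Gam Q c eps f g x = 0.
Proof.
move=> cS fB eps0 L0 bc bf bg cL fL ae x Sx; set S := msupport P in bc bf fL ae Sx *.
have fA : full P S by exact: full_msupport.
have bD := bm_D1 eps fB bc bf bg.
have bE := bm_excess bc bf bg.
set D := D1Gam Q c eps f g in ae bD *.
have DL x1 x2 : S x1 -> S x2 -> `|D x1 - D x2| <= eps^-1 * (2 * L * enorm (x1 - x2)).
  move=> S1 S2; rewrite /D /D1Gam.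
  have -> : forall a b : R, 1 - a - (1 - b) = b - a by move=> a b; ring.
  rewrite -mulrBr normrM (gtr0_norm (_ : 0 < eps^-1)) ?invr_gt0//.
  apply: ler_wpM2l; first by rewrite invr_ge0 ltW.
  have b1 := bm_pair1 S1 bE; have b2 := bm_pair1 S2 bE.
  rewrite -(RintB fB b2 b1); apply: (Rint_abs_le fB); first by bm.
  move=> y By /=; apply: le_trans (pos_diff_le _ _) _.
  have -> : f x2 + g y - c x2 y - (f x1 + g y - c x1 y) =
    (c x1 y - c x2 y) - (f x1 - f x2) by ring.
  apply: le_trans (ler_normB _ _) _.
  by have := cL x1 x2 y; have := fL _ _ S1 S2; lra.
apply/eqP/negPn/negP => Dx.
have nDx : 0 < `|D x| by rewrite normr_gt0.
pose k := 2 * L * d%:R + 1.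
have k0 : 0 < k by rewrite ltr_wpDl// !mulr_ge0// ltW.
have e0 : 0 < `|D x| * eps / k by rewrite divr_gt0// mulr_gt0.
have mN : measurable [set x | D x != 0].
  have [mD _] := bD.
  rewrite (_ : [set x | D x != 0] = ~` (setT `&` D @^-1` [set 0])).
    by apply: measurableC; apply: mD.
  by rewrite setTI; apply/seteqP; split => z /=; move/eqP.
have [x' [Sx' /= nx' xx']] := msupport_dense cS Sx e0 ae mN.
have D0 : D x' = 0 by apply/eqP/negPn/negP.
have := DL _ _ Sx Sx'; rewrite D0 subr0; apply/negP; rewrite -ltNge.
rewrite mulrC ltr_pdivrMr//; have := enorm_ball xx' => h.
apply: (@le_lt_trans _ _ (2 * L * (d%:R * (`|D x| * eps / k)))).
  by rewrite ler_wpM2l// mulr_ge0// ltW.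
move: e0; set e := `|D x| * eps / k => e0.
have -> : `|D x| * eps = e * k by rewrite /e divfK// gt_eqF.
by rewrite /k; nra.
Qed.

Lemma D2GamE (R : realType) (d : nat) (P : probability 'rV[R]_d R)
  (c : 'rV[R]_d -> 'rV[R]_d -> R) (eps : R) f g :
  D2Gam P c eps f g = D1Gam P (fun y x => c x y) eps g f.
Proof.
apply/funext => y; rewrite /D2Gam /D1Gam; congr (1 - _ * _).
by apply: eq_Rintegral => x _; rewrite /excess (addrC (f x)).
Qed.

(** * Strong duality *)

Lemma probability_of_density d (T : measurableType d) (R : realType)
  (mu : probability T R) (h : T -> R) :
  measurable_fun setT h -> (forall x, 0 <= h x) ->
  (\int[mu]_x (h x)%:E = 1)%E ->
  exists nu : probability T R, forall A, nu A = (\int[mu]_(x in A) (h x)%:E)%E.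
Proof.
move=> mh h0 h1.
pose nu (A : set T) : \bar R := (\int[mu]_(x in A) (h x)%:E)%E.
have nu0 : nu set0 = 0%E by rewrite /nu integral_set0.
have nu_ge0 A : (0 <= nu A)%E by apply: integral_ge0 => x _; rewrite lee_fin.
have nu_sa : semi_sigma_additive nu.
  apply: semi_sigma_additive_nng_induced; first exact/measurable_EFinP.
  by move=> x; rewrite lee_fin.
pose mM := isMeasure.Build _ _ _ nu nu0 nu_ge0 nu_sa.
pose nu1 : {measure set T -> \bar R} := HB.pack nu mM.
pose pM := @Measure_isProbability.Build _ _ R nu1 h1.
pose nu2 : probability T R := HB.pack (Measure.sort nu1) pM.
by exists nu2.
Qed.

(** The Radon-Nikodym derivative is extended-real valued; these lemmas compute
    with any real function [h] that agrees with it almost everywhere. *)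
Section radon_nikodym_density.
Local Open Scope charge_scope.
Context d (T : measurableType d) (R : realType) (mu nu : probability T R)
  (A : set T) (h : T -> R).
Hypotheses (mA : full mu A) (nA : full nu A) (numu : nu `<< mu)
  (ih : mu.-integrable setT (EFin \o h))
  (hE : ae_eq mu setT ('d (charge_of_finite_measure nu) '/d mu)%E (EFin \o h)).

Let mh : measurable_fun setT h.
Proof. by apply/measurable_EFinP; exact: measurable_int ih. Qed.

Let mRN : measurable_fun setT ('d (charge_of_finite_measure nu) '/d mu)%E.
Proof. by apply: (measurable_int mu); exact: Radon_Nikodym_integrable. Qed.

Lemma density_Lnorm2 :
  ('N[mu]_2%:E['d (charge_of_finite_measure nu) '/d mu] ^+ 2 =
   \int[mu]_x (h x ^+ 2)%:E)%E.
Proof.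
rewrite Lnorm2_sqr; apply: ge0_ae_eq_integral => //.
- by apply: emeasurable_funM; apply: measurableT_comp.
- by apply/measurable_EFinP; exact: measurable_funX.
- by move=> x _; apply: mule_ge0; exact: abse_ge0.
- by move=> x _; rewrite lee_fin sqr_ge0.
apply: filterS hE => x /(_ I) hx _; rewrite hx /=.
by rewrite -EFinM -expr2 -normrX ger0_norm ?sqr_ge0.
Qed.

Lemma integrable_density (F : T -> R) : bmfun A F ->
  mu.-integrable setT (fun x => (F x * h x)%:E).
Proof.
move=> [mF [M FM]]; have [meA _] := mA.
have mFh : measurable_fun setT (fun x => (F x * h x)%:E).
  by apply/measurable_EFinP; exact: measurable_funM.
apply/(@negligible_integrable _ _ _ mu setT (~` A)) => //.
- exact: measurableC.
- exact: full_setC mA.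
rewrite setTD setCK.
apply: (@le_integrable _ _ _ mu A meA _ (fun x => (`|M|%:E * (h x)%:E)%E)).
- exact: measurable_funTS.
- move=> x Ax; rewrite /= lee_fin !normrM normr_id ler_wpM2r//.
  by apply: le_trans (FM x Ax) _; exact: ler_norm.
- apply: integrableZl => //.
  by apply: (@integrableS _ _ _ _ setT) => //.
Qed.

Lemma Rint_density (F : T -> R) : bmfun A F ->
  \int[mu]_x (F x * h x) = \int[nu]_x F x.
Proof.
move=> bF; have inF := integrable_bm nA bF.
rewrite /Rintegral -(Radon_Nikodym_change_of_variables numu measurableT inF).
congr fine; apply: ae_eq_integral => //.
- by apply: measurable_int (integrable_density bF).
- by apply: emeasurable_funM => //; apply/measurable_EFinP; case: bF.
- apply: filterS hE => x /(_ I) hx _; by rewrite hx /= -EFinM.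
Qed.

End radon_nikodym_density.

Section coupling_marginals.
Context (R : realType) (d : nat).
Local Notation V := 'rV[R]_d.
Variables (P Q : probability V R) (Omega Omega' : set V)
  (pi : probability (V * V)%type R).
Hypotheses (fA : full P Omega) (fB : full Q Omega') (cpl : coupling P Q pi).

Lemma full_coupling : full pi (Omega `*` Omega').
Proof.
case: (fA) (fB) => mA A1 [mB B1]; split; first exact: measurableX.
have mA' : measurable (Omega `*` [set: V]) by exact: measurableX.
have mB' : measurable ([set: V] `*` Omega') by exact: measurableX.
have [A1' _] := cpl mA; have [_ B1'] := cpl mB.
have fA' : full pi (Omega `*` [set: V]) by split => //; rewrite A1'.
have fB' : full pi ([set: V] `*` Omega') by split => //; rewrite B1'.
have n0 : pi (~` (Omega `*` Omega')) = 0%E.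
  apply: (@subset_measure0 _ _ _ pi _
    (~` (Omega `*` [set: V]) `|` ~` ([set: V] `*` Omega'))).
  - by apply: measurableC; exact: measurableX.
  - by apply: measurableU; exact: measurableC.
  - move=> [x y] /= nxy; have [Ox|nOx] := pselect (Omega x).
      by right => -[_ Oy]; apply: nxy.
    by left => -[].
  - rewrite [LHS](@measureU0 _ _ _ pi _ _ (measurableC mA') (measurableC mB') (full_setC fB')).
    exact: full_setC fA'.
have := @probability_setC _ _ _ pi _ (measurableC (measurableX mA mB)).
by rewrite setCK n0 sube0.
Qed.

Lemma Rint_marginal1 (f : V -> R) : bmfun Omega f ->
  \int[pi]_z f z.1 = \int[P]_x f x.
Proof.
move=> bf; rewrite /Rintegral; congr fine.
have mf1 : measurable_fun setT (@fst V V) by exact: measurable_fst.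
have bf1 : bmfun (Omega `*` Omega') (fun z => f z.1) by exact: bm_fst.
have i1 : pi.-integrable (fst @^-1` setT) ((EFin \o f) \o fst).
  rewrite preimage_setT; have := integrable_bm full_coupling bf1.
  by move=> i1; exact: i1.
have mf : measurable_fun setT (EFin \o f) by apply/measurable_EFinP; case: bf.
have := @integral_pushforward _ _ _ _ R fst mf1 pi setT (EFin \o f) mf i1 measurableT.
rewrite preimage_setT => <-; apply: eq_measure_integral => S mS _.
rewrite /pushforward /=; have [<- _] := cpl mS.
by congr (pi _); apply/seteqP; split => [[x y]|[x y] []].
Qed.

Lemma Rint_marginal2 (g : V -> R) : bmfun Omega' g ->
  \int[pi]_z g z.2 = \int[Q]_y g y.
Proof.
move=> bg; rewrite /Rintegral; congr fine.
have mf1 : measurable_fun setT (@snd V V) by exact: measurable_snd.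
have bf1 : bmfun (Omega `*` Omega') (fun z => g z.2) by exact: bm_snd.
have i1 : pi.-integrable (snd @^-1` setT) ((EFin \o g) \o snd).
  rewrite preimage_setT; have := integrable_bm full_coupling bf1.
  by move=> i1; exact: i1.
have mf : measurable_fun setT (EFin \o g) by apply/measurable_EFinP; case: bg.
have := @integral_pushforward _ _ _ _ R snd mf1 pi setT (EFin \o g) mf i1 measurableT.
rewrite preimage_setT => <-; apply: eq_measure_integral => S mS _.
rewrite /pushforward /=; have [_ <-] := cpl mS.
by congr (pi _); apply/seteqP; split => [[x y]|[x y] []].
Qed.

End coupling_marginals.

Section strong_duality.
Local Open Scope charge_scope.
Context (R : realType) (d : nat).
Local Notation V := 'rV[R]_d.
Variables (P Q : probability V R) (Omega Omega' : set V) (c : V -> V -> R)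
  (eps : R).
Hypotheses (fA : full P Omega) (fB : full Q Omega') (eps_gt0 : 0 < eps)
  (bc : bmfun (Omega `*` Omega') (fun z => c z.1 z.2)).
Local Notation PQ := (prod_prob P Q).
Local Notation D1 := (D1Gam Q c eps).
Local Notation D2 := (D2Gam P c eps).
Variables f g : V -> R.
Hypotheses (bf : bmfun Omega f) (bg : bmfun Omega' g).

Let fPQ : full PQ (Omega `*` Omega') := full_prod_prob fA fB.
Let be : bmfun (Omega `*` Omega') (fun z => excess c f g z.1 z.2) :=
  bm_excess bc bf bg.
Let bf1 := bm_fst Omega' bf.
Let bg2 := bm_snd Omega bg.

(** Pointwise this is Young's inequality [W h <= eps h^2 / 2 + W_+^2 / (2 eps)]
    for [h >= 0], where [W = f + g - c] and [h] is the density of the coupling. *)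
Theorem weak_duality (pi : probability (V * V)%type R) : coupling P Q pi ->
  ((Gam P Q c eps f g)%:E <= qot_cost P Q c eps pi)%E.
Proof.
move=> cpl; have fpi := full_coupling fA fB cpl.
have e2 : 0 < eps / 2 by rewrite divr_gt0.
rewrite /qot_cost (integral_bmE fpi bc) /chi2_penalty.
(* without absolute continuity the cost is a finite number plus infinity *)
case: asboolP => [pidom|_]; last by rewrite gt0_muley ?lte_fin// addey ?leey.
(* this version of the density is nonnegative everywhere *)
pose h := fine \o Radon_Nikodym_SigmaFinite.f pi PQ.
have hE : EFin \o h = Radon_Nikodym_SigmaFinite.f pi PQ.
  by apply/funext => z; rewrite /h /= fineK// Radon_Nikodym_SigmaFinite.f_fin_num.
have h0 z : 0 <= h z by rewrite fine_ge0// Radon_Nikodym_SigmaFinite.f_ge0.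
have ih : PQ.-integrable setT (EFin \o h).
  by rewrite hE; exact: Radon_Nikodym_SigmaFinite.f_integrable.
have aeh : ae_eq PQ setT ('d (charge_of_finite_measure pi) '/d PQ)%E (EFin \o h).
  by rewrite hE; apply: ae_eq_sym; exact: ae_eq_Radon_Nikodym_SigmaFinite.
rewrite (density_Lnorm2 pidom ih aeh) //.
have mh2 : measurable_fun setT (fun z => (h z ^+ 2)%:E).
  apply/measurable_EFinP; apply: measurable_funX; apply/measurable_EFinP.
  exact: measurable_int ih.
have [hoo|hfin] := eqVneq (\int[PQ]_z (h z ^+ 2)%:E)%E +oo%E.
  by rewrite hoo gt0_muley ?lte_fin// addey ?leey.
have ih2 : PQ.-integrable setT (fun z => (h z ^+ 2)%:E).
  apply/integrableP; split => //.
  under eq_integral do rewrite gee0_abs ?lee_fin ?sqr_ge0//.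
  by rewrite ltey.
have I2E : (\int[PQ]_z (h z ^+ 2)%:E)%E = (\int[PQ]_z h z ^+ 2)%:E.
  by rewrite /Rintegral fineK//; apply: integrable_fin_num.
rewrite I2E -EFinM -EFinD lee_fin.
have bW : bmfun (Omega `*` Omega') (fun z => f z.1 + g z.2 - c z.1 z.2) by bm.
have bE2 : bmfun (Omega `*` Omega')
    (fun z => (2 * eps)^-1 * excess c f g z.1 z.2 ^+ 2) by bm.
have IW : \int[PQ]_z ((f z.1 + g z.2 - c z.1 z.2) * h z) =
    \int[P]_x f x + \int[Q]_y g y - \int[pi]_z c z.1 z.2.
  rewrite (Rint_density fPQ fpi pidom ih aeh bW).
  rewrite (RintB fpi)//; last by bm.
  by rewrite (RintD fpi)// (Rint_marginal1 fA fB cpl bf) (Rint_marginal2 fA fB cpl bg).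
have GE : Gam P Q c eps f g = \int[P]_x f x + \int[Q]_y g y -
    \int[PQ]_z ((2 * eps)^-1 * excess c f g z.1 z.2 ^+ 2).
  rewrite /Gam (RintB fPQ)//; last by bm.
  rewrite (RintD fPQ)//; congr (_ + _ - _).
    rewrite (Rint_prod12 fA fB)//; apply: eq_Rintegral => x _; exact: (Rint_cst Q (f x)).
  rewrite (Rint_prod21 fA fB)//; apply: eq_Rintegral => y _; exact: (Rint_cst P (g y)).
rewrite GE.
suff : \int[PQ]_z ((f z.1 + g z.2 - c z.1 z.2) * h z) <=
    eps / 2 * \int[PQ]_z h z ^+ 2 + \int[PQ]_z ((2 * eps)^-1 * excess c f g z.1 z.2 ^+ 2).
  by rewrite IW; lra.
have ih2' : PQ.-integrable setT (fun z => (eps / 2 * h z ^+ 2)%:E).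
  exact: (integrableZl measurableT (eps / 2) ih2).
have iE2 := integrable_bm fPQ bE2.
rewrite -RintegralZl// -RintegralD//.
apply: le_Rintegral => //.
- by have := integrable_density fPQ ih bW; exact.
- exact: (integrableD measurableT ih2' iE2).
move=> z _ /=; rewrite /excess; have := h0 z; move: (h z) => t t0.
set W := f z.1 + g z.2 - c z.1 z.2.
have : W * t <= Num.max W 0 * t by rewrite ler_wpM2r// le_max lexx.
move/le_trans; apply; move: (Num.max W 0) => w.
rewrite -subr_ge0 (_ : _ - _ = (2 * eps)^-1 * (eps * t - w) ^+ 2).
  by rewrite mulr_ge0 ?sqr_ge0// invr_ge0 mulr_ge0// ltW.
by field; rewrite gt_eqF.
Qed.

Hypotheses (D10 : forall x, Omega x -> D1 f g x = 0)
  (D20 : forall y, Omega' y -> D2 f g y = 0).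

Let h (z : V * V) := eps^-1 * excess c f g z.1 z.2.

Let bh : bmfun (Omega `*` Omega') h. Proof. by rewrite /h; bm. Qed.

Let h_ge0 z : 0 <= h z.
Proof.
apply: mulr_ge0; first by rewrite invr_ge0 ltW.
by rewrite /excess le_max lexx orbT.
Qed.

Let mh : measurable_fun setT h. Proof. by case: bh. Qed.

Lemma Rint_slice1 x : Omega x -> \int[Q]_y h (x, y) = 1.
Proof.
move=> Ox; have b := bm_pair1 Ox be.
have := D10 Ox; rewrite /D1Gam => /eqP; rewrite subr_eq0 => /eqP ->.
by rewrite /h -(RintZ fB _ b).
Qed.

Lemma Rint_slice2 y : Omega' y -> \int[P]_x h (x, y) = 1.
Proof.
move=> Oy; have b := bm_pair2 Oy be.
have := D20 Oy; rewrite /D2Gam => /eqP; rewrite subr_eq0 => /eqP ->.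
by rewrite /h -(RintZ fA _ b).
Qed.

Lemma integral_slab1 S : measurable S ->
  (\int[PQ]_(z in S `*` setT) (h z)%:E = P S)%E.
Proof.
move=> mS; have mST : measurable (S `*` [set: V]) by exact: measurableX.
have b1S : bmfun Omega (\1_S : V -> R) by exact: bm_indic.
have b1S1 := bm_fst Omega' b1S.
transitivity (\int[PQ]_z (\1_S z.1 * h z)%:E)%E.
  rewrite integral_mkcond; apply: eq_integral => -[x y] _.
  rewrite patchE /= indicE; have [xS|nxS] := boolP (x \in S).
    by rewrite mem_set ?mul1r//; split => //=; apply: set_mem.
  by rewrite memNset ?mul0r//= => -[/mem_set]; rewrite (negbTE nxS).
rewrite (integral_bmE fPQ); last by bm.
rewrite (Rint_prod12 fA fB); last by bm.
rewrite (_ : \int[P]_x _ = \int[P]_x \1_S x).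
  rewrite -(integral_bmE fA b1S) integral_indic//; by rewrite setIT.
apply: (Rint_eq fA) => //.
  by apply: (bm_Rint2 fB (F := fun z => \1_S z.1 * h z)); bm.
move=> x Ox /=; rewrite (RintZ fB); last exact: (bm_pair1 Ox bh).
by rewrite Rint_slice1// mulr1.
Qed.

Lemma integral_slab2 S : measurable S ->
  (\int[PQ]_(z in setT `*` S) (h z)%:E = Q S)%E.
Proof.
move=> mS; have mST : measurable ([set: V] `*` S) by exact: measurableX.
have b1S : bmfun Omega' (\1_S : V -> R) by exact: bm_indic.
have b1S1 := bm_snd Omega b1S.
transitivity (\int[PQ]_z (\1_S z.2 * h z)%:E)%E.
  rewrite integral_mkcond; apply: eq_integral => -[x y] _.
  rewrite patchE /= indicE; have [xS|nxS] := boolP (y \in S).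
    by rewrite mem_set ?mul1r//; split => //=; apply: set_mem.
  by rewrite memNset ?mul0r//= => -[_ /mem_set]; rewrite (negbTE nxS).
rewrite (integral_bmE fPQ); last by bm.
rewrite (Rint_prod21 fA fB); last by bm.
rewrite (_ : \int[Q]_x _ = \int[Q]_x \1_S x).
  rewrite -(integral_bmE fB b1S) integral_indic//; by rewrite setIT.
apply: (Rint_eq fB) => //.
  by apply: (bm_Rint1 fA (F := fun z => \1_S z.2 * h z)); bm.
move=> y Oy /=; rewrite (RintZ fA); last exact: (bm_pair2 Oy bh).
by rewrite Rint_slice2// mulr1.
Qed.

(** The first-order conditions say that [excess / eps] is the density of a
    coupling, whose cost attains the dual value. *)
Theorem strong_duality : QOT P Q c eps = (Gam P Q c eps f g)%:E.
Proof.
apply/eqP; rewrite eq_le; apply/andP; split; last first.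
  by apply: le_ereal_inf_tmp => _ [pi cpl <-]; exact: weak_duality.
have Ih : (\int[PQ]_z (h z)%:E = 1)%E.
  by have := integral_slab1 measurableT; rewrite setXTT => ->; exact: probability_setT.
have [pi piE] := probability_of_density mh h_ge0 Ih.
have cpl : coupling P Q pi.
  by move=> S mS; rewrite !piE integral_slab1// integral_slab2.
have fpi := full_coupling fA fB cpl.
have pidom : pi `<< PQ.
  apply/null_content_dominatesP => A mA A0; rewrite piE.
  apply: null_set_integral => //.
  by apply: measurable_funTS; apply/measurable_EFinP.
have ih := integrable_bm fPQ bh.
have aeh : ae_eq PQ setT ('d (charge_of_finite_measure pi) '/d PQ)%E (EFin \o h).
  apply: integral_ae_eq => //.
  - exact: Radon_Nikodym_integrable.
  - exact/measurable_EFinP.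
  - by move=> A _ mA; rewrite -Radon_Nikodym_integral// -piE.
apply: (@le_trans _ _ (qot_cost P Q c eps pi)).
  by apply: ereal_inf_lbound; exists pi.
rewrite /qot_cost (integral_bmE fpi bc) /chi2_penalty asboolT//.
rewrite (density_Lnorm2 pidom ih aeh)//.
rewrite (integral_bmE fPQ); last by bm.
rewrite -EFinM -EFinD lee_fin -(Rint_density fPQ fpi pidom ih aeh bc).
have := gradient_pairing eps fA fB bc bf bg bf bg.
have -> : \int[P]_x (f x * D1 f g x) = 0.
  rewrite -[RHS](Rint_cst P); apply: (Rint_eq fA); [|bm|].
    by have b1 := bm_D1 eps fB bc bf bg; bm.
  by move=> x Ox; rewrite D10// mulr0.
have -> : \int[Q]_y (g y * D2 f g y) = 0.
  rewrite -[RHS](Rint_cst Q); apply: (Rint_eq fB); [|bm|].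
    by have b2 := bm_D2 eps fA bc bf bg; bm.
  by move=> y Oy; rewrite D20// mulr0.
rewrite addr0 => I0.
rewrite -(RintZ fPQ); last by bm.
rewrite -(RintD fPQ); [|bm|bm].
rewrite /Gam -[leRHS]subr0 -I0 -(RintB fPQ); [|bm|bm].
apply: (Rint_le fPQ); [bm|bm|].
move=> z _ /=; rewrite /h /excess; set W := f z.1 + g z.2 - c z.1 z.2.
have WW : W * Num.max W 0 = Num.max W 0 ^+ 2.
  by case: (leP W 0) => _; rewrite ?expr2// mulr0 mul0r.
have -> : f z.1 + g z.2 = W + c z.1 z.2 by rewrite /W; ring.
move: WW; set w := Num.max W 0 => WW.
rewrite -subr_ge0 (_ : _ - _ = eps^-1 * (W * w - w ^+ 2)).
  by rewrite WW subrr mulr0.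
by field; rewrite gt_eqF.
Qed.

End strong_duality.

(** * A Poincare inequality for sums of two functions *)

Lemma iterated_integral_bmE d1 d2 (T1 : measurableType d1)
  (T2 : measurableType d2) (R : realType) (P : probability T1 R)
  (Q : probability T2 R) (A : set T1) (B : set T2) (F : T1 * T2 -> R) :
  full P A -> full Q B -> bmfun (A `*` B) F -> (forall z, 0 <= F z) ->
  (\int[P]_x \int[Q]_y (F (x, y))%:E = (\int[(P \x Q)%E]_z F z)%R%:E)%E.
Proof.
move=> fA fB bF F0; rewrite -(integral_bmE (full_prod fA fB) bF).
rewrite (fubini_tonelli1 (EFin \o F))//.
by apply/measurable_EFinP; case: bF.
Qed.

Lemma ratio_constant_ge1 (R : realFieldType) (d : nat) (lam Lam : R) (N : nat) :
  0 < lam -> lam <= Lam -> (0 < N)%N ->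
  1 <= Lam ^+ 2 / lam ^+ 2 * N%:R ^+ (d + 2).
Proof.
move=> lam_gt0 lam_Lam N_gt0; rewrite -[leLHS]mulr1 ler_pM//.
  rewrite ler_pdivlMr ?exprn_gt0// mul1r lerXn2r ?nnegrE ?(ltW lam_gt0)//.
  exact: le_trans (ltW lam_gt0) lam_Lam.
by rewrite exprn_ege1// ler1n.
Qed.

(** For each [x], the set [S] contains a product of balls centred at [x] and at
    some [y]; for each [y], a ball of points above [y]. On such a set the sum [u + v] of two functions
    of one variable each controls [u] and [v] everywhere, up to a constant. *)
Section coupled_poincare.
Context (R : realType) (d : nat).
Local Notation V := 'rV[R]_d.
Variables (P Q : probability V R) (Omega Omega' : set V) (rho : V -> R)
  (lam Lam r p0 q0 : R) (N : nat) (S : set (V * V)).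
Hypotheses (fA : full P Omega) (fB : full Q Omega') (cO : convex_set Omega)
  (Prho : has_density P rho) (lam_gt0 : 0 < lam) (lam_Lam : lam <= Lam)
  (rhoB : forall x, Omega x -> lam <= rho x <= Lam) (N_gt0 : (0 < N)%N)
  (diam : forall x x', Omega x -> Omega x' -> enorm (x - x') <= N%:R * r)
  (p0_gt0 : 0 < p0) (p0_le1 : p0 <= 1) (q0_gt0 : 0 < q0) (q0_le1 : q0 <= 1)
  (Pball : forall x, Omega x -> (p0%:E <= P (eball x r))%E)
  (Qball : forall y, Omega' y -> (q0%:E <= Q (eball y r))%E)
  (mS : measurable S)
  (S1 : forall x, Omega x -> exists2 y, Omega' y & forall x' y', Omega x' ->
     Omega' y' -> enorm (x - x') <= r -> enorm (y' - y) < r -> S (x', y'))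
  (S2 : forall y, Omega' y -> exists2 x, Omega x & forall x', Omega x' ->
     enorm (x' - x) < r -> S (x', y)).
Variables u v : V -> R.
Hypotheses (bu : bmfun Omega u) (bv : bmfun Omega' v)
  (u_mean0 : \int[P]_x u x = 0).
Local Notation PQ := (prod_prob P Q).

Let fPQ : full PQ (Omega `*` Omega') := full_prod_prob fA fB.

Lemma measurable_eball (x : V) (s : R) : measurable (eball x s).
Proof.
rewrite (_ : eball x s = (fun y : V => enorm (1 *: y + - x)) @^-1` `]-oo, s[).
  rewrite -[X in measurable X]setTI.
  apply: (@measurableT_comp _ _ _ _ _ _ (@enorm R d)) => //.
    exact: measurable_enorm.
  exact: measurable_affine.
by apply/seteqP; split => y /=; rewrite in_itv/= scale1r.
Qed.

Lemma Rint_indic_ge (mu : probability V R) (A B : set V) (k : R) :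
  full mu A -> measurable B -> (k%:E <= mu B)%E -> k <= \int[mu]_x \1_B x.
Proof.
move=> fmu mB kB; have b1 : bmfun A (\1_B : V -> R) by exact: bm_indic.
rewrite -lee_fin -(integral_bmE fmu b1) integral_indic//.
by rewrite setIT.
Qed.

Let bu1 := bm_fst Omega' bu.
Let bv2 := bm_snd Omega bv.

(** The part of the squared norm of [u + v] that is carried by [S]. *)
Let E (z : V * V) : R := \1_S z * (u z.1 + v z.2) ^+ 2.

Let bE : bmfun (Omega `*` Omega') E.
Proof. by have b1 := bm_indic R (Omega `*` Omega') mS; rewrite /E; bm. Qed.

Let E_ge0 z : 0 <= E z.
Proof. by rewrite mulr_ge0// sqr_ge0. Qed.

(** Integrals over the slices of [S]. *)
Let phi x := \int[Q]_y E (x, y).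
Let psi y := \int[P]_x E (x, y).
Let IS := \int[PQ]_z E z.
Let U := \int[P]_x u x ^+ 2.
Let W := \int[Q]_y v y ^+ 2.

Let bphi : bmfun Omega phi. Proof. exact: (bm_Rint2 fB bE). Qed.
Let bpsi : bmfun Omega' psi. Proof. exact: (bm_Rint1 fA bE). Qed.

(** Two nearby points [x], [x'] see a common ball of points [y'] with
    [(x, y')] and [(x', y')] both in [S]; average over it. *)
Lemma near_diff_le x x' : Omega x -> Omega x' ->
  near_diff Omega r u (x, x') <= 2 / q0 * (phi x + phi x').
Proof.
move=> Ox Ox'.
have phi0 z : 0 <= phi z by apply: Rintegral_ge0 => y _; exact: E_ge0.
have rhs0 : 0 <= 2 / q0 * (phi x + phi x').
  by rewrite mulr_ge0 ?addr_ge0// divr_ge0// ltW.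
rewrite /near_diff indicE; case: (boolP (_ \in _)) => [|_]; last by rewrite mul0r.
rewrite inE => -[_ _ /= xx']; rewrite mul1r.
have [y Oy yS] := S1 Ox; have r0 : 0 <= r := le_trans (enorm_ge0 _) xx'.
set D := (u x - u x') ^+ 2.
have b1 : bmfun Omega' (\1_(eball y r) : V -> R).
  by apply: bm_indic; exact: measurable_eball.
have bEx := bm_pair1 Ox bE; have bEx' := bm_pair1 Ox' bE.
have D0 : 0 <= D by exact: sqr_ge0.
have h : D * \int[Q]_y' \1_(eball y r) y' <= 2 * phi x + 2 * phi x'.
  rewrite -(RintZ fB)// -(RintZ fB)// -(RintZ fB)// -(RintD fB); [|bm|bm].
  apply: (Rint_le fB); [bm|bm|] => y' Oy' /=; rewrite indicE.
  case: (boolP (y' \in _)) => [|_]; last first.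
    by rewrite mulr0 addr_ge0// mulr_ge0.
  rewrite inE /eball /= => yy'.
  have Sx : S (x, y') by apply: yS => //; rewrite subrr enorm0.
  have Sx' : S (x', y') by exact: yS.
  rewrite /E !indicE !mem_set// !mul1r mulr1 /D /=.
  by have := sqr_ge0 (u x + u x' + 2 * v y'); nra.
have q1 := Rint_indic_ge fB (measurable_eball y r) (Qball Oy).
rewrite mulrAC ler_pdivlMr//; apply: le_trans (le_trans _ h) _.
  by rewrite ler_wpM2l.
by rewrite mulrDr.
Qed.

Let C := Lam ^+ 2 / lam ^+ 2 * N%:R ^+ (d + 2).

Let C_ge1 : 1 <= C := ratio_constant_ge1 d lam_gt0 lam_Lam N_gt0.

Lemma variance_le : U <= 2 * C / q0 * IS.
Proof.
have bu21 : bmfun (Omega `*` Omega) (fun z => u z.1) by exact: bm_fst.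
have bu22 : bmfun (Omega `*` Omega) (fun z => u z.2) by exact: bm_snd.
have fPP : full (prod_prob P P) (Omega `*` Omega) := full_prod_prob fA fA.
have bD : bmfun (Omega `*` Omega) (fun z => (u z.1 - u z.2) ^+ 2) by bm.
have bG : bmfun (Omega `*` Omega) (near_diff Omega r u).
  have b1 := bm_indic R (Omega `*` Omega) (measurable_near_pairs fA r).
  by rewrite /near_diff; bm.
have Lam_ge0 : 0 <= Lam by apply: le_trans lam_Lam; exact: ltW.
have [mu _] := bu.
have := local_poincare fA Prho cO lam_gt0 Lam_ge0 rhoB N_gt0 mu diam.
rewrite (iterated_integral_bmE fA fA bD) => [|z]; last exact: sqr_ge0.
rewrite (iterated_integral_bmE fA fA bG) => [|z]; last exact: near_diff_ge0.
rewrite -EFinM lee_fin -/C -/(prod_prob P P) => h.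
have lhs : \int[prod_prob P P]_z (u z.1 - u z.2) ^+ 2 = 2 * U.
  rewrite (Rint_prod12 fA fA bD) /=.
  rewrite (_ : \int[P]_x _ = \int[P]_x (u x ^+ 2 + U)).
    by rewrite (RintD fA) ?(Rint_cst)//; [rewrite -/U; ring|bm|bm].
  apply: (Rint_eq fA); [exact: (bm_Rint2 fA bD)|bm|] => x Ox.
  rewrite (_ : \int[P]_y _ = \int[P]_y (u x ^+ 2 - 2 * u x * u y + u y ^+ 2)); last first.
    by apply: eq_Rintegral => y _; ring.
  rewrite (RintD fA) ?(RintB fA) ?(RintZ fA) ?Rint_cst; try bm.
  by rewrite u_mean0 mulr0 subr0.
have rhs : \int[prod_prob P P]_z near_diff Omega r u z <= 4 / q0 * IS.
  rewrite (Rint_prod12 fA fA bG).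
  apply: (@le_trans _ _ (\int[P]_x (2 / q0 * (phi x + IS)))).
    apply: (Rint_le fA); [exact: (bm_Rint2 fA bG)|bm|] => x Ox.
    have -> : 2 / q0 * (phi x + IS) = \int[P]_x' (2 / q0 * (phi x + phi x')).
      rewrite (RintZ fA) ?(RintD fA) ?Rint_cst; try bm.
      by rewrite /IS (Rint_prod12 fA fB bE).
    apply: (Rint_le fA); [exact: (bm_pair1 Ox bG)|bm|] => x' Ox'.
    exact: near_diff_le.
  rewrite (RintZ fA) ?(RintD fA) ?Rint_cst; try bm.
  rewrite /IS (Rint_prod12 fA fB bE) -/phi.
  by rewrite le_eqVlt; apply/orP; left; apply/eqP; field; rewrite gt_eqF.
have C0 : 0 <= C by apply: le_trans C_ge1.
rewrite lhs in h; have := le_trans h (ler_wpM2l C0 rhs).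
have -> : C * (4 / q0 * IS) = 2 * (2 * C / q0 * IS) by ring.
by lra.
Qed.

(** Recover [v y] from [u + v] and [u] on a ball of points [x] with [(x, y)]
    in [S]. *)
Lemma second_marginal_le : p0 * W <= 2 * IS + 2 * U.
Proof.
rewrite -(RintZ fB); last by bm.
have -> : 2 * IS + 2 * U = \int[Q]_y (2 * psi y + 2 * U).
  rewrite (RintD fB) ?(RintZ fB) ?Rint_cst; try bm.
  by rewrite /IS (Rint_prod21 fA fB bE).
apply: (Rint_le fB); [bm|bm|] => y Oy.
have [x Ox xS] := S2 Oy.
have b1 : bmfun Omega (\1_(eball x r) : V -> R).
  by apply: bm_indic; exact: measurable_eball.
have bEy := bm_pair2 Oy bE.
have p1 := Rint_indic_ge fA (measurable_eball x r) (Pball Ox).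
apply: (@le_trans _ _ (v y ^+ 2 * \int[P]_x' \1_(eball x r) x')).
  by rewrite mulrC ler_wpM2l// sqr_ge0.
rewrite -(RintZ fA)// /psi /U -!(RintZ fA)//; last by bm.
rewrite -(RintD fA); [|bm|bm].
apply: (Rint_le fA); [bm|bm|] => x' Ox' /=; rewrite indicE.
case: (boolP (x' \in _)) => [|_]; last first.
  by rewrite mulr0 addr_ge0// mulr_ge0// sqr_ge0.
rewrite inE /eball /= => xx'.
rewrite /E indicE mem_set/= ?mul1r ?mulr1; last exact: xS.
by have := sqr_ge0 (2 * u x' + v y); nra.
Qed.

(** The squared norm of [u + v] is that of [u] plus that of [v], because [u] is
    centred. *)
Theorem coupled_poincare :
  \int[PQ]_z (u z.1 + v z.2) ^+ 2 <= 8 * C / (p0 * q0) * IS.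
Proof.
have XE : \int[PQ]_z (u z.1 + v z.2) ^+ 2 = U + W.
  exact: (Rint_sqr_sum fA fB bu bv u_mean0).
have IS0 : 0 <= IS by apply: Rintegral_ge0 => z _; exact: E_ge0.
have U0 : 0 <= U by apply: Rintegral_ge0 => z _; exact: sqr_ge0.
have hU := variance_le; have hW := second_marginal_le.
rewrite XE; set K := 2 * C / q0 in hU.
have K2 : 2 <= K.
  rewrite /K ler_pdivlMr//; have := C_ge1; have := q0_le1; move: C => C'; lra.
have -> : 8 * C / (p0 * q0) * IS = 4 * K * IS / p0.
  by rewrite /K; field; rewrite !gt_eqF.
rewrite ler_pdivlMr// mulrC mulrDr.
have h1 : p0 * U <= U by rewrite ler_piMl.
have h2 : 2 * IS <= K * IS by rewrite ler_wpM2r.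
by apply: le_trans (lerD h1 hW) _; rewrite -mulrA; lra.
Qed.

End coupled_poincare.

(** * Gradient ascent *)

Section scalar_step.
Context (R : realFieldType).

(** Since [a_+ - (a + u - w)_+] lies between [0] and [w - u], the middle
    terms below lie between [u] and [w]. *)
Lemma pos_step_itv (a u w t m K : R) : 0 <= t <= 1 -> m <= u <= K ->
  m <= w <= K ->
  m <= u + t * (Num.max a 0 - Num.max (a + (u - w)) 0) <= K.
Proof.
move=> /andP[t0 t1] /andP[mu uK] /andP[mw wK].
by case: (leP a 0) => ha; case: (leP (a + (u - w)) 0) => hb; apply/andP; split; nra.
Qed.

Lemma pos_step_itvN (a u w t m K : R) : 0 <= t <= 1 -> m <= u <= K ->
  m <= w <= K ->
  m <= w - t * (Num.max a 0 - Num.max (a + (u - w)) 0) <= K.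
Proof.
move=> /andP[t0 t1] /andP[mu uK] /andP[mw wK].
by case: (leP a 0) => ha; case: (leP (a + (u - w)) 0) => hb; apply/andP; split; nra.
Qed.

(** Strong monotonicity of the positive part where [a >= eps / 2]. *)
Lemma pos_strong_mono (a e M eps : R) : 0 < eps -> eps <= M -> `|e| <= M ->
  eps / 2 <= a -> eps * e ^+ 2 <= 2 * M * (e * (Num.max (a + e) 0 - Num.max a 0)).
Proof.
move=> e0 eM; rewrite ler_norml => /andP[Me eM'] ea.
have M0 : 0 < M by apply: lt_le_trans eM.
have a0 : 0 < a by apply: lt_le_trans ea; rewrite divr_gt0.
rewrite (max_idPl (ltW a0)); case: (leP (a + e) 0) => hb.
  have -> : e * (0 - a) = - e * a by ring.
  have e_le0 : 0 <= - e by lra.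
  have h1 : - e * (eps / 2) <= - e * a by rewrite ler_wpM2l.
  have h2 : - e * (- e) <= - e * M by rewrite ler_wpM2l//; lra.
  have h3 : M * (- e * (eps / 2)) <= M * (- e * a) by rewrite ler_wpM2l// ltW.
  have h4 : eps * (- e * - e) <= eps * (- e * M) by rewrite ler_wpM2l// ltW.
  by lra.
have -> : e * (a + e - a) = e ^+ 2 by ring.
have : eps * e ^+ 2 <= M * e ^+ 2 by rewrite ler_wpM2r// sqr_ge0.
have : 0 <= M * e ^+ 2 by rewrite mulr_ge0 ?sqr_ge0// ltW.
by lra.
Qed.

Lemma pos_mono (a e : R) : 0 <= e * (Num.max (a + e) 0 - Num.max a 0).
Proof. by case: (leP a 0) => ha; case: (leP (a + e) 0) => hb; nra. Qed.

End scalar_step.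

(** If [|u x + v y| <= E] for all [x], [y], then the values of [u] and [- v] fit
    in an interval of length [2 E]. *)
Lemma common_interval (R : realType) (T1 T2 : Type) (A : set T1) (B : set T2)
  (u : T1 -> R) (v : T2 -> R) (E : R) : A !=set0 -> B !=set0 ->
  (forall x y, A x -> B y -> `|u x + v y| <= E) ->
  exists m, (forall x, A x -> m <= u x <= m + 2 * E) /\
            (forall y, B y -> m <= - v y <= m + 2 * E).
Proof.
move=> [x0 Ax0] [y0 By0] uv.
pose T := [set u x | x in A] `|` [set - v y | y in B].
have near p q : T p -> T q -> p - 2 * E <= q.
  have l x y : A x -> B y -> - E <= u x + v y <= E.
    by move=> Ax By; rewrite -ler_norml uv.
  move=> [[x Ax <-]|[y By <-]] [[x' Ax' <-]|[y' By' <-]].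
  - by have := l _ _ Ax By0; have := l _ _ Ax' By0; lra.
  - by have := l _ _ Ax By'; have := l _ _ Ax By0; have := l _ _ Ax0 By'; lra.
  - by have := l _ _ Ax' By; have := l _ _ Ax' By0; lra.
  - by have := l _ _ Ax0 By; have := l _ _ Ax0 By'; lra.
have T0 : T (u x0) by left; exists x0.
have lbT : has_lbound T by exists (u x0 - 2 * E) => q Tq; exact: near.
have infT p : T p -> inf T <= p <= inf T + 2 * E.
  move=> Tp; apply/andP; split; first exact: ge_inf.
  by rewrite -lerBlDr; apply: lb_le_inf; [exists (u x0)|move=> q Tq; exact: near].
exists (inf T); split=> [x Ax|y By]; apply: infT; [left|right].
  by exists x.
by exists y.
Qed.

Section gradient_ascent.
Context (R : realType) (d : nat).
Local Notation V := 'rV[R]_d.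
Variables (P Q : probability V R) (Omega Omega' : set V) (c : V -> V -> R)
  (eps eta : R).
Hypotheses (fA : full P Omega) (fB : full Q Omega') (eps_gt0 : 0 < eps)
  (bc : bmfun (Omega `*` Omega') (fun z => c z.1 z.2))
  (eta_gt0 : 0 < eta) (eta_lt : eta < eps).
Local Notation PQ := (prod_prob P Q).
Local Notation D1 := (D1Gam Q c eps).
Local Notation D2 := (D2Gam P c eps).
Local Notation Gamma := (Gam P Q c eps).
Let fPQ : full PQ (Omega `*` Omega') := full_prod_prob fA fB.

Variables fs gs : V -> R.
Hypotheses (bfs : bmfun Omega fs) (bgs : bmfun Omega' gs)
  (D10 : forall x, Omega x -> D1 fs gs x = 0)
  (D20 : forall y, Omega' y -> D2 fs gs y = 0).

(** The squared norm of the gradient in [L^2(P) x L^2(Q)]. *)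
Definition sqr_grad (f g : V -> R) : R :=
  \int[P]_x D1 f g x ^+ 2 + \int[Q]_y D2 f g y ^+ 2.

Section one_step.
Variables f g : V -> R.
Hypotheses (bf : bmfun Omega f) (bg : bmfun Omega' g).
Let f' x := f x + eta * D1 f g x.
Let g' y := g y + eta * D2 f g y.
Let be := bm_excess bc bf bg.
Let bes := bm_excess bc bfs bgs.
Let bD1 := bm_D1 eps fB bc bf bg.
Let bD2 := bm_D2 eps fA bc bf bg.

Lemma D1_diff x : Omega x ->
  D1 f g x = eps^-1 * \int[Q]_y (excess c fs gs x y - excess c f g x y).
Proof.
move=> Ox; have b1 := bm_pair1 Ox be; have b2 := bm_pair1 Ox bes.
rewrite (RintB fB b2 b1) mulrBr; have := D10 Ox; rewrite /D1Gam => /eqP.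
by rewrite subr_eq0 => /eqP <-.
Qed.

Lemma D2_diff y : Omega' y ->
  D2 f g y = eps^-1 * \int[P]_x (excess c fs gs x y - excess c f g x y).
Proof.
move=> Oy; have b1 := bm_pair2 Oy be; have b2 := bm_pair2 Oy bes.
rewrite (RintB fA b2 b1) mulrBr; have := D20 Oy; rewrite /D2Gam => /eqP.
by rewrite subr_eq0 => /eqP <-.
Qed.

Let t_itv : 0 <= eta / eps <= 1.
Proof.
by rewrite divr_ge0 ?(ltW eps_gt0) ?(ltW eta_gt0)//= ler_pdivrMr// mul1r ltW.
Qed.

Let excessE x y : excess c f g x y =
  Num.max (fs x + gs y - c x y + ((f x - fs x) - (gs y - g y))) 0.
Proof. by rewrite /excess; congr (Num.max _ 0); ring. Qed.

(** A step replaces [f - fs] and [gs - g] by averages of convex combinations of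
    their values. *)
Lemma step_invariant (m K : R) :
  (forall x, Omega x -> m <= f x - fs x <= K) ->
  (forall y, Omega' y -> m <= gs y - g y <= K) ->
  (forall x, Omega x -> m <= f' x - fs x <= K) /\
  (forall y, Omega' y -> m <= gs y - g' y <= K).
Proof.
move=> fI gI; split => [x Ox|y Oy].
  have b1 := bm_pair1 Ox be; have b2 := bm_pair1 Ox bes.
  have -> : f' x - fs x = \int[Q]_y (f x - fs x + eta / eps *
      (excess c fs gs x y - excess c f g x y)).
    rewrite (RintD fB) ?(RintZ fB) ?Rint_cst; try bm.
    by rewrite /f' D1_diff// mulrA; ring.
  have bi : bmfun Omega' (fun y => f x - fs x + eta / eps *
      (excess c fs gs x y - excess c f g x y)) by bm.
  have itv y : Omega' y -> m <= f x - fs x + eta / eps *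
      (excess c fs gs x y - excess c f g x y) <= K.
    by move=> Oy; rewrite excessE; apply: pos_step_itv; [|exact: fI|exact: gI].
  by rewrite (Rint_ge fB bi) ?(Rint_bound fB bi)// => y /itv/andP[].
have b1 := bm_pair2 Oy be; have b2 := bm_pair2 Oy bes.
have -> : gs y - g' y = \int[P]_x (gs y - g y - eta / eps *
    (excess c fs gs x y - excess c f g x y)).
  rewrite (RintB fA) ?(RintZ fA) ?Rint_cst; try bm.
  by rewrite /g' D2_diff// mulrA; ring.
have bi : bmfun Omega (fun x => gs y - g y - eta / eps *
    (excess c fs gs x y - excess c f g x y)) by bm.
have itv x : Omega x -> m <= gs y - g y - eta / eps *
    (excess c fs gs x y - excess c f g x y) <= K.
  by move=> Ox; rewrite excessE; apply: pos_step_itvN; [|exact: fI|exact: gI].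
by rewrite (Rint_ge fA bi) ?(Rint_bound fA bi)// => x /itv/andP[].
Qed.

Lemma bm_step : bmfun Omega f' /\ bmfun Omega' g'.
Proof. by rewrite /f' /g'; split; bm. Qed.

(** The quadratic term is bounded by [(p + q)^2 <= 2 (p^2 + q^2)]; hence the
    gain is positive for [eta < eps]. *)
Lemma step_ascent :
  Gamma f g + eta * (1 - eta / eps) * sqr_grad f g <= Gamma f' g'.
Proof.
have bphi : bmfun Omega (fun x => eta * D1 f g x) by bm.
have bpsi : bmfun Omega' (fun y => eta * D2 f g y) by bm.
apply: le_trans (Gam_ge_quadratic fA fB eps_gt0 bc bf bg bphi bpsi).
have -> : \int[P]_x (eta * D1 f g x * D1 f g x) = eta * \int[P]_x D1 f g x ^+ 2.
  by rewrite -(RintZ fA); [apply: eq_Rintegral => x _; rewrite mulrA|bm].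
have -> : \int[Q]_y (eta * D2 f g y * D2 f g y) = eta * \int[Q]_y D2 f g y ^+ 2.
  by rewrite -(RintZ fB); [apply: eq_Rintegral => x _; rewrite mulrA|bm].
have bD11 := bm_fst Omega' bD1; have bD22 := bm_snd Omega bD2.
have sq : \int[PQ]_z (eta * D1 f g z.1 + eta * D2 f g z.2) ^+ 2 <=
    2 * eta ^+ 2 * sqr_grad f g.
  have -> : sqr_grad f g = \int[PQ]_z (D1 f g z.1 ^+ 2 + D2 f g z.2 ^+ 2).
    rewrite (RintD fPQ); [|bm|bm]; congr (_ + _).
      rewrite (Rint_prod12 fA fB); last by bm.
      by apply: eq_Rintegral => x _ /=; rewrite Rint_cst.
    rewrite (Rint_prod21 fA fB); last by bm.
    by apply: eq_Rintegral => x _ /=; rewrite Rint_cst.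
  rewrite -(RintZ fPQ); last by bm.
  apply: (Rint_le fPQ); [bm|bm|] => z _ /=.
  move: (D1 f g z.1) (D2 f g z.2) => p q.
  have := sqr_ge0 (eta * (p - q)); rewrite exprMn; nra.
have i0 : 0 <= (2 * eps)^-1 by rewrite invr_ge0 mulr_ge0// ltW.
have := ler_wpM2l i0 sq.
have -> : (2 * eps)^-1 * (2 * eta ^+ 2 * sqr_grad f g) =
    eta * (eta / eps) * sqr_grad f g by field; rewrite gt_eqF.
by rewrite /sqr_grad; lra.
Qed.

End one_step.

(** [S] lies in the region where [fs + gs - c >= eps / 2], and the norm on [S] of
    a sum of two functions controls its full norm. *)
Section error_bound.
Variables (S : set (V * V)) (k M : R).
Hypotheses (mS : measurable S)
  (S_large : forall x y, S (x, y) -> eps / 2 <= fs x + gs y - c x y)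
  (k_gt0 : 0 < k) (eps_le_M : eps <= M)
  (poincare : forall u v, bmfun Omega u -> bmfun Omega' v ->
    \int[P]_x u x = 0 -> \int[PQ]_z (u z.1 + v z.2) ^+ 2 <=
      k * \int[PQ]_z (\1_S z * (u z.1 + v z.2) ^+ 2)).
Variables f g : V -> R.
Hypotheses (bf : bmfun Omega f) (bg : bmfun Omega' g)
  (errM : forall x y, Omega x -> Omega' y ->
     `|f x + g y - (fs x + gs y)| <= M).
Let u x := f x - fs x.
Let v y := g y - gs y.
Let bu : bmfun Omega u. Proof. by rewrite /u; bm. Qed.
Let bv : bmfun Omega' v. Proof. by rewrite /v; bm. Qed.
Let be := bm_excess bc bf bg.
Let bes := bm_excess bc bfs bgs.
Let bD1 := bm_D1 eps fB bc bf bg.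
Let bD2 := bm_D2 eps fA bc bf bg.
Let bu1 := bm_fst Omega' bu.
Let bv2 := bm_snd Omega bv.
Let b1S := bm_indic R (Omega `*` Omega') mS.

(** The pairing of the gradient with [(fs - f, gs - g)]. *)
Let B := - \int[PQ]_z ((u z.1 + v z.2) * (1 - eps^-1 * excess c f g z.1 z.2)).
Let X := \int[PQ]_z (u z.1 + v z.2) ^+ 2.

Lemma suboptimality_le_pairing : Gamma fs gs - Gamma f g <= B.
Proof.
have bmu : bmfun Omega (fun x => - u x) by bm.
have bmv : bmfun Omega' (fun x => - v x) by bm.
have := Gam_le_tangent fA fB eps_gt0 bc bf bg bmu bmv.
have -> : (fun x => f x + - u x) = fs by apply/funext => x; rewrite /u; ring.
have -> : (fun x => g x + - v x) = gs by apply/funext => x; rewrite /v; ring.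
rewrite -(gradient_pairing eps fA fB bc bf bg bmu bmv).
have -> : \int[PQ]_z ((- u z.1 + - v z.2) * (1 - eps^-1 * excess c f g z.1 z.2)) = B.
  rewrite /B -(RintN fPQ); last by bm.
  by apply: eq_Rintegral => z _; rewrite -opprD mulNr.
by lra.
Qed.

(** The first-order conditions at [(fs, gs)] turn the pairing into the integral
    of a monotone expression. *)
Lemma local_norm_le_pairing :
  \int[PQ]_z (\1_S z * (u z.1 + v z.2) ^+ 2) <= 2 * M * B.
Proof.
have I0 : \int[PQ]_z ((u z.1 + v z.2) * (1 - eps^-1 * excess c fs gs z.1 z.2)) = 0.
  rewrite (gradient_pairing eps fA fB bc bfs bgs bu bv).
  rewrite (_ : \int[P]_x _ = 0) ?add0r.
    rewrite -[RHS](Rint_cst Q); apply: (Rint_eq fB); [|bm|].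
      by have b2 := bm_D2 eps fA bc bfs bgs; bm.
    by move=> y Oy; rewrite D20// mulr0.
  rewrite -[RHS](Rint_cst P); apply: (Rint_eq fA); [|bm|].
    by have b1 := bm_D1 eps fB bc bfs bgs; bm.
  by move=> y Oy; rewrite D10// mulr0.
have -> : B = \int[PQ]_z ((u z.1 + v z.2) *
    (eps^-1 * (excess c f g z.1 z.2 - excess c fs gs z.1 z.2))).
  rewrite /B -[LHS]addr0 -I0 addrC -(RintB fPQ); [|bm|bm].
  by apply: eq_Rintegral => z _; ring.
rewrite -(RintZ fPQ); last by bm.
apply: (Rint_le fPQ); [bm|bm|] => -[x y] [Ox Oy] /=.
have ex : excess c f g x y = Num.max (fs x + gs y - c x y + (u x + v y)) 0.
  by rewrite /excess /u /v; congr (Num.max _ 0); ring.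
have eE : f x + g y - (fs x + gs y) = u x + v y by rewrite /u /v; ring.
have M0 : 0 < M by apply: lt_le_trans eps_le_M.
have rhsE : forall e w : R, 2 * M * (e * (eps^-1 * w)) = eps^-1 * (2 * M * (e * w)).
  by move=> e w; ring.
rewrite rhsE ex [excess c fs gs x y]/excess indicE; case: (boolP (_ \in S)) => [|_]; last first.
  rewrite mul0r mulr_ge0 ?invr_ge0 ?(ltW eps_gt0)//.
  by rewrite mulr_ge0 ?pos_mono// mulr_ge0// ltW.
rewrite inE mul1r => Sxy; rewrite mulrC ler_pdivlMr// mulrC.
by apply: pos_strong_mono => //; [rewrite -eE; exact: errM|exact: S_large].
Qed.

Let t := 2 * k * M.

Let t_gt0 : 0 < t.
Proof. by rewrite !mulr_gt0//; apply: lt_le_trans eps_le_M. Qed.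

(** Only the sum [u + v] matters, so [u] may be centred; the squared norms of
    [u] and [v] then add up to the squared norm of the sum. *)
Lemma pairing_young : B <= t / 2 * sqr_grad f g + X / (2 * t).
Proof.
pose m := \int[P]_x u x.
pose u0 x := u x - m.
pose v0 y := v y + m.
have bu0 : bmfun Omega u0 by rewrite /u0; bm.
have bv0 : bmfun Omega' v0 by rewrite /v0; bm.
have mu0 : \int[P]_x u0 x = 0.
  by rewrite /u0 (RintB fA) ?Rint_cst ?subrr; bm.
have uv z : u z.1 + v z.2 = u0 z.1 + v0 z.2 by rewrite /u0 /v0; ring.
have BE : B = \int[P]_x (- (u0 x * D1 f g x)) + \int[Q]_y (- (v0 y * D2 f g y)).
  rewrite (RintN fA) ?(RintN fB); try bm.
  rewrite -opprD -(gradient_pairing eps fA fB bc bf bg bu0 bv0) /B; congr (- _).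
  by apply: eq_Rintegral => z _; rewrite uv.
have XE : X = \int[P]_x u0 x ^+ 2 + \int[Q]_y v0 y ^+ 2.
  rewrite -(Rint_sqr_sum fA fB bu0 bv0 mu0) /X.
  by apply: eq_Rintegral => z _; rewrite uv.
have young (p q : R) : - (p * q) <= t / 2 * q ^+ 2 + (2 * t)^-1 * p ^+ 2.
  rewrite -subr_ge0 (_ : _ - _ = (2 * t)^-1 * (p + t * q) ^+ 2).
    by rewrite mulr_ge0 ?sqr_ge0// invr_ge0 mulr_ge0// ltW.
  by field; rewrite gt_eqF.
have h1 : \int[P]_x (- (u0 x * D1 f g x)) <=
    t / 2 * \int[P]_x D1 f g x ^+ 2 + (2 * t)^-1 * \int[P]_x u0 x ^+ 2.
  rewrite -!(RintZ fA) -?(RintD fA); try bm.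
  by apply: (Rint_le fA) => [||x _]; [bm|bm|exact: young].
have h2 : \int[Q]_y (- (v0 y * D2 f g y)) <=
    t / 2 * \int[Q]_y D2 f g y ^+ 2 + (2 * t)^-1 * \int[Q]_y v0 y ^+ 2.
  rewrite -!(RintZ fB) -?(RintD fB); try bm.
  by apply: (Rint_le fB) => [||x _]; [bm|bm|exact: young].
rewrite BE XE /sqr_grad [_ / (2 * t)]mulrC; apply: le_trans (lerD h1 h2) _.
by rewrite !mulrDr; lra.
Qed.

Lemma norm_le_pairing : X <= t * B.
Proof.
pose m := \int[P]_x u x.
have bu0 : bmfun Omega (fun x => u x - m) by bm.
have bv0 : bmfun Omega' (fun y => v y + m) by bm.
have mu0 : \int[P]_x (u x - m) = 0 by rewrite (RintB fA) ?Rint_cst ?subrr; bm.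
have uv z : u z.1 - m + (v z.2 + m) = u z.1 + v z.2 by ring.
have := poincare bu0 bv0 mu0.
under eq_Rintegral do rewrite uv.
under [X in _ <= _ * X -> _]eq_Rintegral do rewrite uv.
rewrite -/X => /le_trans; apply.
have := ler_wpM2l (ltW k_gt0) local_norm_le_pairing.
by rewrite /t; lra.
Qed.

(** Combine [X <= t B] with Young's inequality for [B] and absorb [X / 2]. *)
Theorem error_bound : X <= t ^+ 2 * sqr_grad f g.
Proof.
have := norm_le_pairing; have := ler_wpM2l (ltW t_gt0) pairing_young.
have -> : t * (t / 2 * sqr_grad f g + X / (2 * t)) =
    t ^+ 2 * sqr_grad f g / 2 + X / 2 by field; rewrite gt_eqF.
by lra.
Qed.

Theorem polyak_lojasiewicz : Gamma fs gs - Gamma f g <= t * sqr_grad f g.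
Proof.
apply: le_trans suboptimality_le_pairing _; apply: le_trans pairing_young _.
have i0 : 0 <= (2 * t)^-1 by rewrite invr_ge0 mulr_ge0// ltW.
have := ler_wpM2l i0 error_bound.
have -> : (2 * t)^-1 * (t ^+ 2 * sqr_grad f g) = t / 2 * sqr_grad f g.
  by field; rewrite gt_eqF.
by rewrite mulrC; lra.
Qed.

End error_bound.
End gradient_ascent.

(** * Geometric constants *)

Section geometry.
Context (R : realType) (d : nat).
Local Notation V := 'rV[R]_d.

Lemma positive_lower_bound (T : eqType) (phi : T -> R) (s : seq T) :
  (forall x, x \in s -> 0 < phi x) ->
  exists2 q, 0 < q & forall x, x \in s -> q <= phi x.
Proof.
elim: s => [|a s IHs] s0; first by exists 1.
have [x xs|q q0 qs] := IHs; first by apply: s0; rewrite inE xs orbT.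
exists (Num.min q (phi a)); first by rewrite lt_min q0 s0// mem_head.
move=> x; rewrite inE => /predU1P[->|/qs qx]; rewrite ge_min ?lexx ?orbT//.
by rewrite qx.
Qed.

Lemma eball_ball (x y : V) (s r : R) : d%:R * (s + s) < r -> ball x s y ->
  ball x s `<=` eball y r.
Proof.
move=> dsr xy z xz; rewrite /eball /= -enormN opprB.
apply: le_lt_trans dsr; apply: enorm_ball.
by apply: (ball_triangle _ xz); exact: ball_sym.
Qed.

(** The infimum over the support of the measures of balls of fixed radius is
    positive: cover the support by finitely many smaller balls, each of positive
    measure. *)
Lemma eball_measure_lower_bound (mu : probability V R) (r : R) :
  compact (msupport mu) -> 0 < r ->
  exists2 q, 0 < q & forall y, msupport mu y -> q <= fine (mu (eball y r)).
Proof.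
move=> cS r0; pose s := r / (2 * d%:R + 1).
have k0 : 0 < 2 * d%:R + 1 :> R by rewrite ltr_wpDl// mulr_ge0.
have s0 : 0 < s by rewrite divr_gt0.
have dsr : d%:R * (s + s) < r.
  have -> : r = s * (2 * d%:R + 1) by rewrite /s divfK// gt_eqF.
  by lra.
have finmu (A : set V) : measurable A -> mu A \is a fin_num.
  by move=> mA; exact: fin_num_measure.
have mball x : measurable (ball (x : V) s).
  by apply: rV_open_measurable; exact: ball_open.
have ccov : cover_compact (msupport mu) by rewrite -compact_cover.
have opn (x : V) : msupport mu x -> open (ball x s) by move=> _; exact: ball_open.
have cov0 : msupport mu `<=` cover (msupport mu) (fun x : V => ball x s).
  by move=> x Sx; exists x => //; exact: ballxx.
have [D DS cov] := ccov _ _ _ opn cov0.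
have Dpos x : x \in finmap.enum_fset D -> 0 < fine (mu (ball x s)).
  move=> Dx; have := DS x Dx; rewrite inE => Sx.
  apply: fine_gt0; rewrite ltey_eq finmu// andbT; apply: (Sx _ (opn _ Sx)).
  exact: ballxx.
have [q q0 qD] := positive_lower_bound Dpos.
exists q => // y Sy; have [x Dx xy] := cov _ Sy.
apply: le_trans (qD x Dx) _; apply: fine_le; rewrite ?finmu//.
  exact: measurable_eball.
apply: le_measure; rewrite ?inE//; first exact: measurable_eball.
exact: eball_ball.
Qed.

Lemma enorm_eq0 (v : V) : enorm v <= 0 -> v = 0.
Proof.
move=> v0; have /eqP : enorm v = 0 by apply/eqP; rewrite eq_le v0 enorm_ge0.
rewrite sqrtr_eq0 => h.
have /eqP : \sum_(i < d) v ord0 i ^+ 2 == 0.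
  by rewrite eq_le h sumr_ge0// => i _; exact: sqr_ge0.
move/psumr_eq0P => /(_ (fun i _ => sqr_ge0 _)) v2.
by apply/rowP => i; rewrite mxE; apply/eqP; rewrite -sqrf_eq0 v2.
Qed.

Lemma lebesgue_rV_set1 (x : V) : (0 < d)%N -> lebesgue_rV d [set x] = 0%E.
Proof.
move=> d0.
transitivity (lebesgue_rV d
    [set y : V | forall i, y ord0 i \in `[x ord0 i, x ord0 i]]).
  congr (lebesgue_rV d _); apply/seteqP; split => y /=.
    by move=> -> i; rewrite in_itv/= lexx.
  move=> yx; apply/rowP => i; have := yx i; rewrite in_itv/=.
  by move=> h; apply/eqP; rewrite eq_le andbC.
apply: (etrans (lebesgue_rV_box (fun i => lexx (x ord0 i)))).
by rewrite (bigD1 (Ordinal d0))//= subrr mul0r.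
Qed.

(** A measure with a bounded density charges no point. *)
Lemma ediam_gt0 (P : probability V R) (rho : V -> R) (Omega : set V)
  (lam Lam : R) : (0 < d)%N -> compact Omega -> full P Omega ->
  has_density P rho -> (forall x, Omega x -> lam <= rho x <= Lam) ->
  0 <= lam -> 0 < ediam Omega.
Proof.
move=> d0 cO fA Prho rhoB lam0; rewrite ltNge; apply/negP => diam0.
have [x0 Ox0] := full_nonempty fA.
have OE : Omega = [set x0].
  apply/seteqP; split => [x Ox|x ->//] /=.
  apply/eqP; rewrite -subr_eq0; apply/eqP/enorm_eq0.
  by apply: le_trans diam0; exact: enorm_le_ediam.
have [mO P1] := fA.
have /andP[_] := density_measure_bounds Prho lam0 rhoB mO (@subset_refl _ Omega).
by rewrite P1 {1}OE lebesgue_rV_set1// mule0 lee_fin ler10.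
Qed.

End geometry.

Lemma natr_ceil (R : archiRealFieldType) (x : R) : 0 < x ->
  exists2 N : nat, (0 < N)%N & (Num.ceil x)%:~R = N%:R :> R.
Proof.
move=> x0; have c0 : 0 < Num.ceil x by rewrite ceil_gt0.
exists `|Num.ceil x|%N; first by rewrite absz_gt0 gt_eqF.
by rewrite -[in LHS](gez0_abs (ltW c0)) pmulrn.
Qed.

Lemma max_inv_pow (R : realFieldType) (r : R) n : 0 < r ->
  Num.max r^-1 1 ^+ n = (Num.min (r ^+ n) 1)^-1.
Proof.
move=> r0; case: (leP r 1) => r1.
  have i1 : 1 <= r^-1 by rewrite invf_ge1.
  by rewrite (max_idPl i1) exprVn (min_idPl _)// exprn_ile1// ltW.
have i1 : r^-1 <= 1 by rewrite invf_le1// ltW.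
by rewrite (max_idPr i1) expr1n (min_idPr _) ?invr1// exprn_ege1// ltW.
Qed.

(** * Linear convergence *)

Lemma linear_rate (R : realFieldType) (delta X D : nat -> R) (s t : R) :
  0 < s -> s <= t -> (forall n, 0 <= delta n) ->
  (forall n, delta n.+1 <= delta n - s * D n) ->
  (forall n, delta n <= t * D n) -> (forall n, X n <= t ^+ 2 * D n) ->
  forall n, delta n <= (1 - s / t) ^+ n * delta 0%N /\
    X n <= t ^+ 2 / s * delta 0%N * (1 - s / t) ^+ n.
Proof.
move=> s0 st delta0 step pl eb.
have t0 : 0 < t by apply: lt_le_trans st.
have rate n : delta n <= (1 - s / t) ^+ n * delta 0%N.
  elim: n => [|n IHn]; first by rewrite expr0 mul1r.
  have q0 : 0 <= 1 - s / t by rewrite subr_ge0 ler_pdivrMr// mul1r.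
  rewrite exprS -mulrA; apply: le_trans (ler_wpM2l q0 IHn).
  apply: le_trans (step n) _; rewrite mulrBl mul1r lerD2l lerN2.
  by rewrite mulrAC ler_pdivrMr// -mulrA ler_wpM2l ?(ltW s0)// mulrC.
move=> n; split => //; apply: le_trans (eb n) _.
have Dn : D n <= delta n / s.
  by rewrite ler_pdivlMr// mulrC; have := step n; have := delta0 n.+1; lra.
apply: (@le_trans _ _ (t ^+ 2 * (delta n / s))).
  by rewrite ler_wpM2l// sqr_ge0.
have -> : t ^+ 2 / s * delta 0%N * (1 - s / t) ^+ n =
  t ^+ 2 * ((1 - s / t) ^+ n * delta 0%N / s) by ring.
by rewrite ler_wpM2l ?sqr_ge0// ler_wpM2r// invr_ge0 ltW.
Qed.

(** The positive part of [f x + g - c x] has mean [eps], so it reaches [eps]. *)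
Lemma D1Gam_eq0_large (R : realType) (d : nat) (Q : probability 'rV[R]_d R)
  (Omega Omega' : set 'rV[R]_d) (c : 'rV[R]_d -> 'rV[R]_d -> R) (eps : R) f g x :
  full Q Omega' -> 0 < eps ->
  bmfun (Omega `*` Omega') (fun z => c z.1 z.2) -> bmfun Omega f ->
  bmfun Omega' g -> Omega x -> D1Gam Q c eps f g x = 0 ->
  exists2 y, Omega' y & eps <= f x + g y - c x y.
Proof.
move=> fB eps0 bc bf bg Ox; rewrite /D1Gam => /eqP; rewrite subr_eq0 => /eqP I1.
have be := bm_pair1 Ox (bm_excess bc bf bg).
have Ie : \int[Q]_y excess c f g x y = eps.
  by rewrite -[LHS](mulVKf (lt0r_neq0 eps0)) -I1 mulr1.
apply: contrapT => small.
have le_eps y : Omega' y -> f x + g y - c x y < eps.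
  by move=> Oy; rewrite ltNge; apply/negP => h; apply: small; exists y.
have [|y Oy /=] := Rint_attains fB be _ Ie.
  by move=> y Oy; rewrite /= /excess ge_max (ltW (le_eps y Oy)) ltW.
move=> h; have := le_eps y Oy; rewrite -[X in _ < X -> _]h /excess lt_max.
rewrite ltxx /= => neg; move: h; rewrite /excess (max_idPr (ltW neg)) => e0.
by rewrite -e0 ltxx in eps0.
Qed.

Theorem corollary2p6 (R : realType) (d : nat) (eps : R)
  (P Q : probability 'rV[R]_d R) (Omega Omega' : set 'rV[R]_d)
  (rho : 'rV[R]_d -> R) (lam Lam L delta : R)
  (c : 'rV[R]_d -> 'rV[R]_d -> R)
  (fs gs f0 g0 : 'rV[R]_d -> R) (eta : R)
  (d_ge1 : (1 <= d)%N) (eps_gt0 : 0 < eps)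
  (OmegaE : Omega = msupport P) (Omega_convex : convex_set Omega)
  (Omega_compact : compact Omega)
  (P_density : has_density P rho)
  (lam_gt0 : 0 < lam) (lam_Lam : lam < Lam)
  (rho_bounds : forall x, Omega x -> lam <= rho x <= Lam)
  (Omega'E : Omega' = msupport Q) (Omega'_compact : compact Omega')
  (L_gt0 : 0 < L) (c_lipschitz : elipschitz2 L c)
  (delta_gt0 : 0 < delta) (delta_le1 : delta <= 1)
  (deltaP : forall (r : R) (x : 'rV[R]_d), 0 < r -> Omega x ->
    ((delta * Num.min (r ^+ d) 1)%:E <= P (eball x r))%E)
  (fs_gs_max : dual_maximizer P Q c eps fs gs)
  (fs_lipschitz : elipschitz L Omega fs)
  (gs_lipschitz : elipschitz L Omega' gs)
  (f0_bounded : Linfty Omega f0) (g0_bounded : Linfty Omega' g0)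
  (eta_gt0 : 0 < eta) (eta_lt : eta < eps) :
  let f n := (grad_iter P Q c eps eta f0 g0 n).1 in
  let g n := (grad_iter P Q c eps eta f0 g0 n).2 in
  let err n := osum (f n) (g n) \- osum fs gs in
  let supdist n := supnorm (Omega `*` Omega') (err n) in
  let Delta n := gap P Q c eps (f n) (g n) in
  let gamma := gamma_const eps L lam Lam delta Q Omega Omega' in
  let M := Num.max (2 * fine (supdist 0%N)) eps in
  let q := eta * (1 - eta / eps) / (gamma * M) in
  forall n : nat, (1 <= n)%N ->
  [/\ (supdist n <= 2%:E * supdist 0%N)%E,
      (Delta n <= ((1 - q) ^+ n)%:E * Delta 0%N)%E &
      ('N[prod_prob P Q]_2%:E[EFin \o err n] ^+ 2 <=
        (gamma ^+ 2 * M ^+ 2 / (eta * (1 - eta / eps)))%:E *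
        Delta 0%N * ((1 - q) ^+ n)%:E)%E].
Proof.
move=> f g err supdist Delta gamma M q.
have L0 := ltW L_gt0; have lam_ge0 := ltW lam_gt0.
have fA : full P Omega by rewrite OmegaE; apply: full_msupport; rewrite -OmegaE.
have fB : full Q Omega'.
  by rewrite Omega'E; apply: full_msupport; rewrite -Omega'E.
have cS := elipschitz2_sum L0 c_lipschitz.
have [x0 Ox0] := full_nonempty fA; have [y0 Oy0] := full_nonempty fB.
have bfs : bmfun Omega fs.
  split; last exact: elipschitz_bounded fs_lipschitz.
  by case: fs_gs_max; rewrite inE => /andP[]; rewrite inE.
have bgs : bmfun Omega' gs.
  split; last exact: elipschitz_bounded gs_lipschitz.
  by case: fs_gs_max => _; rewrite inE => /andP[]; rewrite inE.
have bc : bmfun (Omega `*` Omega') (fun z => c z.1 z.2).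
  split; first exact: elipschitz2_measurable c_lipschitz.
  have [K1 _ OK] := enorm_bounded Omega_compact.
  have [K2 _ OK'] := enorm_bounded Omega'_compact.
  exists (`|c x0 y0| + L * (K1 + K2)) => -[x y] [/= Ox Oy].
  rewrite -[c x y](subrK (c x0 y0)) addrC; apply: le_trans (ler_normD _ _) _.
  rewrite lerD2l; apply: le_trans (cS _ _ _ _) _.
  by rewrite ler_wpM2l// lerD ?OK ?OK'.
have bcT : bmfun (Omega' `*` Omega) (fun z => c z.2 z.1).
  have [mc [K cK]] := bc; split; last by exists K => -[y x] [/= Oy Ox]; exact: (cK (x, y)).
  apply: (@measurableT_comp _ _ _ _ _ _ (fun z => c z.1 z.2) _ (fun z => (z.2, z.1))) => //.
  exact: measurable_fun_pair.
have D10 x : Omega x -> D1Gam Q c eps fs gs x = 0.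
  have := maximizer_D1_ae fA fB eps_gt0 bc bfs bgs fs_gs_max.
  move: Omega_compact bc bfs fs_lipschitz; rewrite OmegaE => cO bc' bfs' fsL ae.
  apply: (D1Gam_eq0 cO fB eps_gt0 L_gt0 bc' bfs' bgs) => // x1 x2 y.
  by have := cS x1 y x2 y; rewrite subrr enorm0 addr0.
have D20 y : Omega' y -> D2Gam P c eps fs gs y = 0.
  have := maximizer_D2_ae fA fB eps_gt0 bc bfs bgs fs_gs_max.
  move: Omega'_compact bcT bgs gs_lipschitz.
  rewrite D2GamE Omega'E => cO bc' bgs' gsL ae.
  apply: (D1Gam_eq0 cO fA eps_gt0 L_gt0 bc' bgs' bfs) => // y1 y2 x.
  by have := cS x y1 x y2; rewrite subrr enorm0 add0r.
have QOTE := strong_duality fA fB eps_gt0 bc bfs bgs D10 D20.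
(* the iterates are measurable everywhere, bounded on the supports *)
have bfg n : bmfun Omega (f n) /\ bmfun Omega' (g n).
  by elim: n => [//|n [bf bg]]; exact: bm_step.
have fPQ := full_prod_prob fA fB.
have bz0 : (Omega `*` Omega') (x0, y0) by [].
have berr n : bmfun (Omega `*` Omega') (err n).
  have [bf bg] := bfg n; rewrite /err /osum.
  have h1 := bm_fst Omega' bf; have h2 := bm_snd Omega bg.
  by have h3 := bm_fst Omega' bfs; have h4 := bm_snd Omega bgs; bm.
(* the sup norm of the initial error is finite, so that [fine] is harmless *)
have [E0 sup0] : exists E0, supdist 0%N = E0%:E.
  have [_ [K errK]] := berr 0%N; exists (fine (supdist 0%N)); rewrite fineK//.
  rewrite ge0_fin_numE.
    apply: (@le_lt_trans _ _ K%:E); last exact: ltry.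
    by apply: ge_ereal_sup => _ [z Oz <-]; rewrite lee_fin; exact: errK.
  apply: (@le_trans _ _ (`|err 0%N (x0, y0)|%:E)); first by rewrite lee_fin.
  by apply: ereal_sup_ubound; exists (x0, y0).
have err0 x y : Omega x -> Omega' y -> `|(f 0%N x - fs x) + (g 0%N y - gs y)| <= E0.
  move=> Ox Oy; rewrite -lee_fin -sup0.
  apply: ereal_sup_ubound; exists (x, y) => //=; congr (`|_|%:E).
  by rewrite /err /osum /=; ring.
have [m [m0 m0']] := common_interval (ex_intro _ _ Ox0) (ex_intro _ _ Oy0) err0.
have itv n : (forall x, Omega x -> m <= f n x - fs x <= m + 2 * E0) /\
    (forall y, Omega' y -> m <= gs y - g n y <= m + 2 * E0).
  elim: n => [|n [IHf IHg]].
    by split => // y Oy; rewrite -opprB; exact: m0'.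
  have [bf bg] := bfg n.
  exact: (step_invariant fA fB eps_gt0 bc eta_gt0 eta_lt bfs bgs D10 D20 bf bg IHf IHg).
have errn n x y : Omega x -> Omega' y ->
    `|f n x + g n y - (fs x + gs y)| <= 2 * E0.
  move=> Ox Oy; have [/(_ x Ox)/andP[h1 h2] /(_ y Oy)/andP[h3 h4]] := itv n.
  by rewrite ler_norml; apply/andP; split; lra.
have ME : M = Num.max (2 * E0) eps by rewrite /M sup0.
have eps_le_M : eps <= M by rewrite ME le_max lexx orbT.
have M0 : 0 < M by apply: lt_le_trans eps_le_M.
have errM n x y : Omega x -> Omega' y -> `|f n x + g n y - (fs x + gs y)| <= M.
  by move=> Ox Oy; apply: le_trans (errn n _ _ Ox Oy) _; rewrite ME le_max lexx.
(* At scale [r] the function [fs + gs - c], which is [2 L]-Lipschitz in each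
   variable, drops by at most [eps / 2] from a point where it reaches [eps]. *)
pose r := eps / (8 * L).
have r0 : 0 < r by rewrite divr_gt0// mulr_gt0.
(* otherwise the ceiling, hence [gamma], would vanish *)
have diam0 := ediam_gt0 d_ge1 Omega_compact fA P_density rho_bounds lam_ge0.
have arg0 : 0 < 8 * L * ediam Omega / eps by rewrite divr_gt0// !mulr_gt0.
have [N N0 NE] := natr_ceil arg0.
have diam x x' : Omega x -> Omega x' -> enorm (x - x') <= N%:R * r.
  move=> Ox Ox'; apply: le_trans (enorm_le_ediam Omega_compact Ox Ox') _.
  rewrite -NE; apply: (@le_trans _ _ (8 * L * ediam Omega / eps * r)).
    rewrite le_eqVlt; apply/orP; left; apply/eqP; rewrite /r.
    by field; rewrite !gt_eqF.
  by rewrite ler_wpM2r ?(ltW r0)// ceil_ge.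
pose p0 := delta * Num.min (r ^+ d) 1.
have p0_gt0 : 0 < p0 by rewrite mulr_gt0// lt_min exprn_gt0//=.
have p0_le1 : p0 <= 1.
  by rewrite mulr_ile1 ?(ltW delta_gt0)// ?ge_min ?lexx ?orbT// le_min exprn_ge0 ?(ltW r0)/=.
pose q0 := inf [set fine (Q (eball y r)) | y in Omega'].
have cO'' : compact (msupport Q) by rewrite -Omega'E.
have [q1 q1_gt0 Qq1] := eball_measure_lower_bound cO'' r0.
have lbq : lbound [set fine (Q (eball y r)) | y in Omega'] q1.
  by move=> _ [y Oy <-]; apply: Qq1; rewrite -Omega'E.
have q0_gt0 : 0 < q0.
  apply: lt_le_trans q1_gt0 _; apply: lb_le_inf => //.
  by exists (fine (Q (eball y0 r))); exists y0.
have Qfin y : Q (eball y r) = (fine (Q (eball y r)))%:E.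
  by rewrite fineK//; apply: fin_num_measure; exact: measurable_eball.
have Qball y : Omega' y -> (q0%:E <= Q (eball y r))%E.
  move=> Oy; rewrite Qfin lee_fin; apply: ge_inf; first by exists q1.
  by exists y.
have q0_le1 : q0 <= 1.
  rewrite -lee_fin; apply: le_trans (Qball y0 Oy0) _.
  by apply: probability_le1; exact: measurable_eball.
pose a x y := fs x + gs y - c x y.
pose S : set ('rV[R]_d * 'rV[R]_d) := [set z | eps / 2 <= a z.1 z.2].
have mS : measurable S.
  have ma : measurable_fun setT (fun z => a z.1 z.2).
    have [mc _] := bc; have [mfs _] := bfs; have [mgs _] := bgs.
    by apply: measurable_funB => //; apply: measurable_funD; exact: measurableT_comp.
  rewrite (_ : S = setT `&` (fun z => a z.1 z.2) @^-1` `[eps / 2, +oo[%classic).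
    exact: ma.
  by rewrite setTI; apply/seteqP; split => z; rewrite /S /= in_itv/= andbT.
have aL x y x' y' : Omega x -> Omega x' -> Omega' y -> Omega' y' ->
    a x y - 2 * L * (enorm (x - x') + enorm (y - y')) <= a x' y'.
  move=> Ox Ox' Oy Oy'; have := cS x y x' y'.
  have := fs_lipschitz x x' Ox Ox'; have := gs_lipschitz y y' Oy Oy'.
  by rewrite !ler_norml => /andP[h1 h2] /andP[h3 h4] /andP[h5 h6]; rewrite /a; lra.
have Lr : L * r = eps / 8 by rewrite /r; field; rewrite gt_eqF.
have S1 x : Omega x -> exists2 y, Omega' y & forall x' y', Omega x' ->
    Omega' y' -> enorm (x - x') <= r -> enorm (y' - y) < r -> S (x', y').
  move=> Ox; have [y Oy axy] := D1Gam_eq0_large fB eps_gt0 bc bfs bgs Ox (D10 x Ox).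
  exists y => // x' y' Ox' Oy' xx' yy'; rewrite /S /=.
  have := aL x y x' y' Ox Ox' Oy Oy'; rewrite -enormN opprB in yy'.
  have h1 := ler_wpM2l L0 xx'; have h2 := ler_wpM2l L0 (ltW yy').
  by move: axy; rewrite -/(a x y); lra.
have S2 y : Omega' y -> exists2 x, Omega x & forall x', Omega x' ->
    enorm (x' - x) < r -> S (x', y).
  move=> Oy; have D := D20 y Oy; rewrite D2GamE in D.
  have [x Ox axy] := D1Gam_eq0_large fA eps_gt0 bcT bgs bfs Oy D.
  exists x => // x' Ox' xx'; rewrite /S /=.
  have := aL x y x' y Ox Ox' Oy Oy; rewrite subrr enorm0 addr0.
  rewrite -enormN opprB in xx'; have h1 := ler_wpM2l L0 (ltW xx').
  by move: axy; rewrite (addrC (gs y)) -/(a x y); lra.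
pose C := Lam ^+ 2 / lam ^+ 2 * N%:R ^+ (d + 2).
have C1 : 1 <= C := ratio_constant_ge1 d lam_gt0 (ltW lam_Lam) N0.
pose k := 8 * C / (p0 * q0).
have C0 : 0 < C := lt_le_trans ltr01 C1.
have k_gt0 : 0 < k by rewrite /k divr_gt0// mulr_gt0.
have Pball x : Omega x -> (p0%:E <= P (eball x r))%E by move=> Ox; exact: deltaP.
have poin u v : bmfun Omega u -> bmfun Omega' v -> \int[P]_x u x = 0 ->
    \int[prod_prob P Q]_z (u z.1 + v z.2) ^+ 2 <=
      k * \int[prod_prob P Q]_z (\1_S z * (u z.1 + v z.2) ^+ 2).
  move=> bu bv u0.
  exact: (coupled_poincare fA fB Omega_convex P_density lam_gt0 (ltW lam_Lam)
    rho_bounds N0 diam p0_gt0 p0_le1 q0_gt0 q0_le1 Pball Qball mS S1 S2 bu bv u0).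
have gammaE : gamma = 2 * k.
  rewrite /gamma /gamma_const NE -/r -/q0.
  have -> : 8 * L / eps = r^-1 by rewrite /r invf_div.
  rewrite max_inv_pow// /k /C /p0; field.
  by rewrite !gt_eqF//= lt_min exprn_gt0//=.
pose s := eta * (1 - eta / eps).
have s0 : 0 < s by rewrite mulr_gt0// subr_gt0 ltr_pdivrMr// mul1r.
have gamma1 : 1 <= gamma.
  rewrite gammaE /k (_ : 2 * _ = 16 * C / (p0 * q0)); last by ring.
  rewrite ler_pdivlMr; last by rewrite mulr_gt0.
  rewrite mul1r.
  have : p0 * q0 <= 1 by rewrite mulr_ile1 ?(ltW p0_gt0) ?(ltW q0_gt0).
  by lra.
(* so that [1 - q >= 0] *)
have st : s <= gamma * M.
  apply: (@le_trans _ _ M); last by rewrite ler_peMl// ltW.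
  apply: le_trans eps_le_M; apply: le_trans (ltW eta_lt).
  by rewrite ler_piMr ?(ltW eta_gt0)// gerBl divr_ge0// ltW.
pose del n := Gam P Q c eps fs gs - Gam P Q c eps (f n) (g n).
pose X n := \int[prod_prob P Q]_z err n z ^+ 2.
pose D n := sqr_grad P Q c eps (f n) (g n).
have del0 n : 0 <= del n.
  rewrite subr_ge0; have [bf bg] := bfg n; have [_ _] := fs_gs_max; apply.
    exact: bm_Lfun2 fA bf.
  exact: bm_Lfun2 fB bg.
have step n : del n.+1 <= del n - s * D n.
  have [bf bg] := bfg n.
  have := step_ascent eta fA fB eps_gt0 bc bf bg.
  by rewrite -/s /del /D /f /g /=; lra.
have tE : gamma * M = 2 * k * M by rewrite gammaE.
have pl n : del n <= gamma * M * D n.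
  have [bf bg] := bfg n; rewrite tE.
  exact: (polyak_lojasiewicz fA fB eps_gt0 bc bfs bgs D10 D20 mS
    (fun x y Sxy => Sxy) k_gt0 eps_le_M poin bf bg (errM n)).
have eb n : X n <= (gamma * M) ^+ 2 * D n.
  have [bf bg] := bfg n; rewrite tE.
  have := error_bound fA fB eps_gt0 bc bfs bgs D10 D20 mS
    (fun x y Sxy => Sxy) k_gt0 eps_le_M poin bf bg (errM n).
  rewrite (_ : \int[_]_z _ = X n)//.
  by apply: eq_Rintegral => z _; rewrite /err /osum /=; congr (_ ^+ 2); ring.
have DeltaE n : Delta n = (del n)%:E by rewrite /Delta /gap QOTE -EFinB.
move=> n _; have [rate rateX] := linear_rate s0 st del0 step pl eb n.
split.
- rewrite sup0 -EFinM; apply: ge_ereal_sup => _ [[x y] [Ox Oy] <-].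
  by rewrite lee_fin; exact: errn.
- by rewrite !DeltaE -EFinM lee_fin.
- rewrite (Lnorm2_sqr_bm fPQ (berr n)) DeltaE -!EFinM lee_fin -exprMn.
  exact: rateX.
Qed.
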